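(* Let $k\in\mathbb N$, $k\ge2$, let $E$ be a symmetric space with the Fatou property, and consider the conditions: (i) $E$ is locally fully $k$-rotund. (ii) $E^+$ is locally fully $k$-rotund. (iii) $E^d$ is locally fully $k$-rotund. Then (i)$\Leftrightarrow$(ii)$\Rightarrow$(iii). If $E$ is order continuous, then (iii)$\Rightarrow$(i).
   Context: Let $I=[0,\alpha)$, $\alpha=1$ or $\alpha=\infty$, with Lebesgue measure $\mu$, and $L^0$ the set of (classes of) extended real valued measurable functions on $I$. A Banach function space $(E,\|\cdot\|_E)$ is a Banach lattice that is a sublattice of $L^0$ such that (1) if $x\in L^0$, $y\in E$, $|x|\le|y|$ a.e., then $x\in E$ and $\|x\|_E\le\|y\|_E$; (2) there is a strictly positive $x\in E$. $S_E$ is the unit sphere. For $x\in L^0$: $d_x(\lambda)=\mu\{s\in I:|x(s)|>\lambda\}$ and $x^*(t)=\inf\{\lambda>0:d_x(\lambda)\le t\}$. A symmetric space is a Banach function space $E$ such that $x\in L^0$, $y\in E$, $d_x=d_y$ imply $x\in E$ and $\|x\|_E=\|y\|_E$. $E^+=\{x\in E:x\ge0\}$ and $E^d=\{x^*:x\in E\}$ (the cone of nonnegative decreasing elements of $E$). Fatou property: if $(x_n)\subset E^+$, $\sup_n\|x_n\|_E<\infty$ and $x_n\uparrow x\in L^0$, then $x\in E$ and $\|x_n\|_E\uparrow\|x\|_E$. $E$ is order continuous if for every $x\in E$ and every $(x_n)\subset E^+$ with $x_n\le|x|$ and $x_n\to0$ a.e. one has $\|x_n\|_E\to0$. For $C\in\{E,E^+,E^d\}$,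 $C$ is locally fully $k$-rotund if for every $x\in S_E\cap C$ and every sequence $(x_n)\subset S_E\cap C$ such that $\|x+\sum_{i=1}^k x_{n,i}\|_E\to k+1$ as $n\to\infty$ for any $k$ subsequences $(x_{n,1})_n,\dots,(x_{n,k})_n$ of $(x_n)$, one has $\|x_n-x\|_E\to0$. *)

(* Defs.v *)
From HB Require Import structures.
From mathcomp Require Import all_boot all_order all_algebra.
From mathcomp Require Import all_classical all_reals all_analysis.
From mathcomp Require Import measurable_realfun.
Set Implicit Arguments.
Unset Strict Implicit.
Unset Printing Implicit Defensive.
Import Order.TTheory GRing.Theory Num.Theory.
Import numFieldNormedType.Exports.

Local Open Scope classical_set_scope.
Local Open Scope ring_scope.
Local Open Scope ereal_scope.

Section FunctionsOnI.
Context {R : realType}.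
Variable alpha : \bar R.

(* The interval [0, alpha). *)
Definition dom : set R := [set t | (0 <= t)%R /\ t%:E < alpha].

(* Classes in L^0 are handled through representatives R -> \bar R whose values
   off [dom] are irrelevant. The library's sigma-algebra on R is the Borel one;
   every Lebesgue measurable function is a.e. equal to a Borel one, so the
   classes are the same. *)
Definition L0 : set (R -> \bar R) := [set x : R -> \bar R | measurable_fun dom x].

Definition ae_on (P : R -> Prop) : Prop :=
  {ae (@lebesgue_measure R), forall t, dom t -> P t}.

Definition distr (x : R -> \bar R) (l : R) : \bar R :=
  lebesgue_measure (dom `&` [set s | l%:E < `|x s|]).

Definition rearrangement (x : R -> \bar R) (t : R) : \bar R :=
  ereal_inf [set l%:E | l in [set l : R | (0 < l)%R /\ distr x l <= t%:E]].

(* The norm is only meaningful on the carrier. By [bfs_solid] both the carrier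
   and the norm are compatible with a.e. equality. Elements of the carrier are
   finite a.e.: if |x| = +oo on A, then y = +oo * 1_A is in the carrier by
   [bfs_solid] and satisfies 2 y = y, so ||y|| = 0 and A is null. Hence the
   convention for +oo - oo plays no role in pointwise sums. *)
Record banachFunctionSpace := BanachFunctionSpace {
  bfs_car : set (R -> \bar R) ;
  bfs_norm : (R -> \bar R) -> R ;
  bfs_L0 : bfs_car `<=` L0 ;
  bfs_add : forall x y, bfs_car x -> bfs_car y ->
    bfs_car (fun t => x t + y t) ;
  bfs_scale : forall (a : R) x, bfs_car x -> bfs_car (fun t => a%:E * x t) ;
  bfs_max : forall x y, bfs_car x -> bfs_car y ->
    bfs_car (fun t => Order.max (x t) (y t)) ;
  bfs_min : forall x y, bfs_car x -> bfs_car y ->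
    bfs_car (fun t => Order.min (x t) (y t)) ;
  bfs_norm_ge0 : forall x, bfs_car x -> (0 <= bfs_norm x)%R ;
  bfs_norm_eq0 : forall x, bfs_car x -> bfs_norm x = 0%R ->
    ae_on (fun t => x t = 0) ;
  bfs_normZ : forall (a : R) x, bfs_car x ->
    bfs_norm (fun t => a%:E * x t) = (`|a| * bfs_norm x)%R ;
  bfs_normD : forall x y, bfs_car x -> bfs_car y ->
    (bfs_norm (fun t => x t + y t)%E <= bfs_norm x + bfs_norm y)%R ;
  bfs_complete : forall xs : nat -> R -> \bar R, (forall n, bfs_car (xs n)) ->
    (forall e : R, (0 < e)%R -> exists N : nat, forall m n : nat,
      (N <= m)%N -> (N <= n)%N ->
      (bfs_norm (fun t => xs m t - xs n t)%E < e)%R) ->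
    exists2 x, bfs_car x &
      bfs_norm (fun t => xs n t - x t) @[n --> \oo] --> (0 : R)%R ;
  bfs_solid : forall x y, L0 x -> bfs_car y ->
    ae_on (fun t => `|x t| <= `|y t|) ->
    bfs_car x /\ (bfs_norm x <= bfs_norm y)%R ;
  bfs_pos : exists2 x, bfs_car x & ae_on (fun t => 0 < x t)
}.

Implicit Types E : banachFunctionSpace.

Definition symmetric_space E : Prop :=
  forall x y, L0 x -> bfs_car E y ->
    (forall l : R, (0 <= l)%R -> distr x l = distr y l) ->
    bfs_car E x /\ bfs_norm E x = bfs_norm E y.

Definition unit_sphere E : set (R -> \bar R) :=
  [set x | bfs_car E x /\ bfs_norm E x = 1%R].

Definition positive_cone E : set (R -> \bar R) :=
  [set x | bfs_car E x /\ ae_on (fun t => 0 <= x t)].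

(* Representatives of the classes of the functions x^*, x in E. *)
Definition decreasing_cone E : set (R -> \bar R) :=
  [set y | bfs_car E y /\
    exists2 x, bfs_car E x & ae_on (fun t => y t = rearrangement x t)].

Definition fatou_property E : Prop :=
  forall (xs : nat -> R -> \bar R) (x : R -> \bar R),
    (forall n, positive_cone E (xs n)) ->
    has_ubound (range (fun n => bfs_norm E (xs n))) ->
    L0 x ->
    ae_on (fun t => nondecreasing_seq (xs^~ t) /\
                    xs n t @[n --> \oo] --> x t) ->
    [/\ bfs_car E x, nondecreasing_seq (fun n => bfs_norm E (xs n)) &
        bfs_norm E (xs n) @[n --> \oo] --> bfs_norm E x].

Definition order_continuous E : Prop :=
  forall (x : R -> \bar R) (xs : nat -> R -> \bar R),
    bfs_car E x -> (forall n, positive_cone E (xs n)) ->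
    (forall n, ae_on (fun t => xs n t <= `|x t|)) ->
    ae_on (fun t => xs n t @[n --> \oo] --> 0) ->
    bfs_norm E (xs n) @[n --> \oo] --> (0 : R)%R.

(* The subsequence (x_{n,i})_n is (xs (phi i n))_n, phi i strictly increasing. *)
Definition locally_fully_rotund (k : nat) E (C : set (R -> \bar R)) : Prop :=
  forall (x : R -> \bar R) (xs : nat -> R -> \bar R),
    (unit_sphere E `&` C) x -> (forall n, (unit_sphere E `&` C) (xs n)) ->
    (forall phi : 'I_k -> nat -> nat,
      (forall i, {homo phi i : m n / (m < n)%N}) ->
      bfs_norm E (fun t => x t + \sum_(i < k) xs (phi i n) t) @[n --> \oo]
        --> (k.+1%:R : R)%R) ->
    bfs_norm E (fun t => xs n t - x t) @[n --> \oo] --> (0 : R)%R.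

End FunctionsOnI.

(* Main.v *)
(* For (ii) => (i), the moduli |x_n| and the averages z_n = |x + x_n|/2 both satisfy the
   hypothesis relative to |x|, the latter because
     |x + sum_i x_i| <= (2/k) sum_i z_i + (1 - 1/k) sum_i |x_i| ;
   hence |x_n| and z_n tend to |x|, and |a - b| + |a + b| = 2 max(|a|, |b|) gives x_n -> x.

   For (iii) => (ii), the norm of a sum of nonnegative functions is at most the norm of the
   sum of their rearrangements, so that (iii) applies to x* and to the x_n*, and also to the
   rearrangements of the midpoints y_n = (x + x_n)/2: both x_n* and y_n* tend to x* in norm.
   As E embeds locally in L^1, the integrals of (x_n - l)^+ and of (y_n - l)^+ tend to
   that of (x - l)^+ for every l > 0.  The strict convexity gap of r |-> (r - l)^+ then shows
   that {x > l + e, x_n < l - e} and {x_n > l + e, x < l - e} have small measure, so x_n -> x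
   in measure.  Finally (x_n - x)^+ and (x - x_n)^+ have rearrangements tending to 0
   pointwise and bounded by x_n* and x*, and order continuity applies.

   The norm inequality for rearrangements and the local L^1 bound are proved for sums of
   indicator functions.  Up to equidistribution these are approximated by functions constant
   on N equal cells; on such functions the norm is a convex function invariant under
   permutations, which increases when the sets are compressed to initial segments and
   decreases when one averages over cyclic shifts. *)
Require Import Defs.
From HB Require Import structures.
From mathcomp Require Import all_boot all_order all_algebra.
From mathcomp Require Import all_classical all_reals all_analysis.
From mathcomp Require Import perm.
From mathcomp Require Import measurable_realfun.
From mathcomp Require Import ring lra.
Set Implicit Arguments.
Unset Strict Implicit.
Unset Printing Implicit Defensive.
Import Order.TTheory GRing.Theory Num.Theory.
Import numFieldNormedType.Exports.

Local Open Scope classical_set_scope.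
Local Open Scope ring_scope.

(** * Function spaces of real-valued functions *)

Section Dom.
Context {R : realType} (alpha : \bar R).

(** Convergence of x_n* to x* concerns distributions alone and cannot see where x_n is large. The
    midpoints are there because their distribution depends on how x and x_n are placed relative to
    each other. Midpoints and the averages z_n have norms that merely tend to 1, so the rotundity
    hypothesis has to be extended to such sequences. Excesses over levels l > 0, rather than whole
    integrals, are compared because on [0, oo) an element of E need not be integrable, whereas order
    continuity gives every set {|x| > l} finite measure; this finiteness is also what allows level
    sets to be cut into finitely many cells of equal length. Order continuity moreover turns
    pointwise convergence of rearrangements under a fixed majorant into convergence of norms, so
    functions need only be approximated in distribution. *)

Lemma dom_itv : dom alpha = [set` Interval (BLeft 0) (if alpha is r%:E then BLeft r
  else if alpha is +oo%E then BInfty _ false else BInfty _ true)].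
Proof.
apply/seteqP; split=> t /=; rewrite /dom /= in_itv /=; case: alpha => [r||] /=.
- by rewrite lte_fin => -[-> ->].
- by case=> ->.
- by case.
- by rewrite lte_fin => /andP.
- by rewrite andbT ltry => ->.
- by rewrite andbF.
Qed.

Lemma measurable_dom : measurable (dom alpha).
Proof. by rewrite dom_itv; exact: measurable_itv. Qed.

#[local] Instance ae_lebesgue_filter : Filter (nbhs (almost_everywhere (@lebesgue_measure R))).
Proof. exact: ae_filter_ringOfSetsType. Qed.

Lemma ae_on_all (P : R -> Prop) : (forall t, dom alpha t -> P t) -> ae_on alpha P.
Proof. by move=> PI; rewrite /ae_on; apply: filterE => t It; exact: PI. Qed.

Lemma ae_onS (P Q : R -> Prop) : (forall t, dom alpha t -> P t -> Q t) ->
  ae_on alpha P -> ae_on alpha Q.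
Proof. by move=> PQ; rewrite /ae_on; apply: filterS => t Pt It; exact/PQ/Pt. Qed.

Lemma ae_onS2 (P Q S : R -> Prop) : ae_on alpha P -> ae_on alpha Q ->
  (forall t, dom alpha t -> P t -> Q t -> S t) -> ae_on alpha S.
Proof.
rewrite /ae_on => aeP aeQ PQ; move: aeP aeQ; apply: filterS2 => t Pt Qt It.
by apply: PQ => //; [exact: Pt|exact: Qt].
Qed.

Lemma ae_on_forall (K : countType) (P : K -> R -> Prop) :
  (forall i, ae_on alpha (P i)) -> ae_on alpha (fun t => forall i, P i t).
Proof.
move=> aeP; have /ae_foralln : forall n : nat, {ae (@lebesgue_measure R), forall t,
    dom alpha t -> forall i, unpickle n = Some i -> P i t}.
  move=> n; case: (unpickle n) => [i|]; last by apply: ae_on_all.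
  by apply: ae_onS (aeP i) => t _ Pt j [<-].
apply: filterS => t Pt It i; exact: (Pt (pickle i) It i (pickleK i)).
Qed.

End Dom.

Section RealFunctions.
Context {R : realType} {alpha : \bar R} (E : banachFunctionSpace alpha).
Implicit Types (x y : R -> \bar R) (u v w : R -> R).

Lemma car_ae_eq x y : bfs_car E x -> L0 alpha y -> ae_on alpha (fun t => y t = x t) ->
  bfs_car E y /\ bfs_norm E y = bfs_norm E x.
Proof.
move=> Ex L0y yx.
have [Ey le1] : bfs_car E y /\ bfs_norm E y <= bfs_norm E x.
  by apply: bfs_solid => //; apply: ae_onS yx => t _ ->.
split=> //; apply/eqP; rewrite eq_le le1 /=.
have [] // := @bfs_solid _ _ E x y (bfs_L0 Ex) Ey.
by apply: ae_onS yx => t _ ->.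
Qed.

Lemma car_fin_num x : bfs_car E x -> ae_on alpha (fun t => x t \is a fin_num).
Proof.
move=> Ex; have mx := bfs_L0 Ex.
(* [fine] sends both infinities to 0, so [y] is 0 where [x] is finite and equals [x] elsewhere. *)
pose y t := (x t - (fine (x t))%:E)%E.
have [Ey _] : bfs_car E y /\ bfs_norm E y <= bfs_norm E x.
  apply: bfs_solid => //.
    apply: emeasurable_funB => //; apply/measurable_EFinP.
    by apply: measurableT_comp => //; exact: fine_measurable.
  apply: ae_on_all => t _; rewrite /y; case: (x t) => [r||] //=.
  by rewrite subrr normr0 lee_fin.
have y0 : bfs_norm E y = 0.
  have := bfs_normZ 2 Ey.
  have -> : (fun t => 2%:E * y t)%E = y.
    apply/funext => t; rewrite /y; case: (x t) => [r||] //=.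
    - by rewrite -EFinB subrr mule0.
    - by rewrite gt0_muley // lte_fin.
    - by rewrite gt0_muleNy // lte_fin.
  by rewrite ger0_norm //; lra.
apply: ae_onS (bfs_norm_eq0 Ey y0) => t _; rewrite /y; by case: (x t).
Qed.

(** Every class has a real-valued representative, by [car_fin_num] and [car_fine]. The argument is
    carried out on these, where the conventions for infinite values disappear and ring identities
    hold pointwise. *)
Definition car_real u := bfs_car E (EFin \o u).
Definition norm_real u := bfs_norm E (EFin \o u).
Local Notation N := norm_real.

Lemma car_fine x : bfs_car E x ->
  car_real (fine \o x) /\ norm_real (fine \o x) = bfs_norm E x.
Proof.
move=> Ex; apply: car_ae_eq => //.
  apply/measurable_EFinP; apply: measurableT_comp; last exact: bfs_L0 Ex.
  exact: fine_measurable.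
by apply: ae_onS (car_fin_num Ex) => t _ /= ?; rewrite fineK.
Qed.

Lemma car_measurable u : car_real u -> measurable_fun (dom alpha) u.
Proof. by move=> /bfs_L0 /measurable_EFinP. Qed.

Lemma car_solid u v : measurable_fun (dom alpha) u -> car_real v ->
  ae_on alpha (fun t => `|u t| <= `|v t|) -> car_real u /\ N u <= N v.
Proof.
by move=> mu Ev uv; apply: bfs_solid => //; exact/measurable_EFinP.
Qed.

Lemma carD u v : car_real u -> car_real v -> car_real (fun t => u t + v t).
Proof. exact: bfs_add. Qed.

Lemma carZ a u : car_real u -> car_real (fun t => a * u t).
Proof. exact: bfs_scale. Qed.

Lemma normZ a u : car_real u -> N (fun t => a * u t) = `|a| * N u.
Proof. exact: bfs_normZ. Qed.

Lemma normD u v : car_real u -> car_real v -> N (fun t => u t + v t) <= N u + N v.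
Proof. exact: bfs_normD. Qed.

Lemma norm_ge0 u : car_real u -> 0 <= N u.
Proof. exact: bfs_norm_ge0. Qed.

Lemma car_zero : car_real (fun=> 0) /\ N (fun=> 0) = 0.
Proof.
have [x /car_fine[Ex _] _] := bfs_pos E.
have -> : (fun=> 0) = (fun t => 0 * (fine \o x) t).
  by apply/funext => t; rewrite mul0r.
by split; [exact: carZ|rewrite normZ // normr0 mul0r].
Qed.

Lemma carB u v : car_real u -> car_real v -> car_real (fun t => u t - v t).
Proof.
move=> Eu Ev; have -> : (fun t => u t - v t) = (fun t => u t + (-1) * v t).
  by apply/funext => t; rewrite mulN1r.
by apply: carD => //; exact: carZ.
Qed.

Lemma car_sum (K : Type) (r : seq K) (P : pred K) (f : K -> R -> R) :
  (forall i, P i -> car_real (f i)) -> car_real (fun t => \sum_(i <- r | P i) f i t).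
Proof.
move=> Ef; elim: r => [|i r IH].
  have -> : (fun t => \sum_(i <- [::] | P i) f i t) = (fun=> 0).
    by apply/funext => t; rewrite big_nil.
  exact: car_zero.1.
case: (boolP (P i)) => Pi; last first.
  suff -> : (fun t => \sum_(j <- i :: r | P j) f j t) =
    (fun t => \sum_(j <- r | P j) f j t) by [].
  by apply/funext => t; rewrite big_cons (negbTE Pi).
have -> : (fun t => \sum_(j <- i :: r | P j) f j t) =
    (fun t => f i t + \sum_(j <- r | P j) f j t).
  by apply/funext => t; rewrite big_cons Pi.
by apply: carD => //; exact: Ef.
Qed.

Lemma norm_sum (K : Type) (r : seq K) (P : pred K) (f : K -> R -> R) :
  (forall i, P i -> car_real (f i)) ->
  N (fun t => \sum_(i <- r | P i) f i t) <= \sum_(i <- r | P i) N (f i).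
Proof.
move=> Ef; elim: r => [|i r IH].
  have -> : (fun t => \sum_(i <- [::] | P i) f i t) = (fun=> 0).
    by apply/funext => t; rewrite big_nil.
  by rewrite big_nil car_zero.2.
rewrite big_cons; case: (boolP (P i)) => Pi; last first.
  suff -> : (fun t => \sum_(j <- i :: r | P j) f j t) =
    (fun t => \sum_(j <- r | P j) f j t) by [].
  by apply/funext => t; rewrite big_cons (negbTE Pi).
have -> : (fun t => \sum_(j <- i :: r | P j) f j t) =
    (fun t => f i t + \sum_(j <- r | P j) f j t).
  by apply/funext => t; rewrite big_cons Pi.
apply: le_trans (normD _ _) _; [exact: Ef|exact: car_sum|by rewrite lerD2l].
Qed.

Lemma norm_le u v : car_real u -> car_real v ->
  ae_on alpha (fun t => `|u t| <= `|v t|) -> N u <= N v.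
Proof. by move=> Eu Ev uv; have [] := car_solid (car_measurable Eu) Ev uv. Qed.

Lemma car_abs u : car_real u -> car_real (fun t => `|u t|) /\ N (fun t => `|u t|) = N u.
Proof.
move=> Eu; have Ea : car_real (fun t => `|u t|).
  have [] // := @car_solid (fun t => `|u t|) u _ Eu.
    by apply: measurableT_comp => //; exact: car_measurable.
  by apply: ae_on_all => t _; rewrite normr_id.
by split=> //; apply/eqP; rewrite eq_le !norm_le //; apply: ae_on_all => t _;
  rewrite normr_id.
Qed.

Lemma norm_dist u v : car_real u -> car_real v ->
  `|N u - N v| <= N (fun t => u t - v t).
Proof.
move=> Eu Ev; have key u' v' : car_real u' -> car_real v' ->
    N u' <= N v' + N (fun t => u' t - v' t).
  move=> Eu' Ev'; have := normD Ev' (carB Eu' Ev').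
  suff -> : (fun t => v' t + (u' t - v' t)) = u' by [].
  by apply/funext => t; rewrite addrC subrK.
have : N (fun t => v t - u t) = N (fun t => u t - v t).
  apply/eqP; rewrite eq_le !norm_le //; try exact: carB;
  by apply: ae_on_all => t _; rewrite distrC.
have := key _ _ Eu Ev; have := key _ _ Ev Eu => ? ? ?.
by rewrite ler_norml; lra.
Qed.

Lemma order_continuous_real (OC : order_continuous E) v (us : nat -> R -> R) :
  car_real v -> (forall n, car_real (us n)) ->
  (forall n, ae_on alpha (fun t => 0 <= us n t <= `|v t|)) ->
  ae_on alpha (fun t => us n t @[n --> \oo] --> 0) ->
  N (us n) @[n --> \oo] --> 0.
Proof.
move=> Ev Eu uv u0; apply: (OC _ _ Ev) => [n|n|].
- split; first exact: Eu.
  by apply: ae_onS (uv n) => t _ /andP[? _]; rewrite lee_fin.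
- by apply: ae_onS (uv n) => t _ /andP[_ ?]; rewrite lee_fin.
- by apply: ae_onS u0 => t _ ut; apply: cvg_EFin => /=; [exact: nearW|exact: ut].
Qed.

End RealFunctions.

(** * Full rotundity: reduction to nonnegative functions *)

Section Sequences.
Context {R : realType}.

Lemma homo_ltn_cvgy (phi : nat -> nat) : {homo phi : m n / (m < n)%N} ->
  phi n @[n --> \oo] --> \oo.
Proof.
move=> hphi; have le_phi n : (n <= phi n)%N.
  by elim: n => // n IH; apply: leq_ltn_trans IH _; exact: hphi.
by apply/cvgnyPge => A; exists A => // n /= An; exact: leq_trans An (le_phi n).
Qed.

Lemma cvg_subsequence (e : nat -> R) (l : R) (phi : nat -> nat) :
  {homo phi : m n / (m < n)%N} -> e n @[n --> \oo] --> l ->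
  e (phi n) @[n --> \oo] --> l.
Proof. by move=> /homo_ltn_cvgy hphi; apply: cvg_comp. Qed.

Lemma cvg_sum_subsequences (k : nat) (e : nat -> R) (l : R) (phi : 'I_k -> nat -> nat) :
  (forall i, {homo phi i : m n / (m < n)%N}) -> e n @[n --> \oo] --> l ->
  \sum_(i < k) e (phi i n) @[n --> \oo] --> k%:R * l.
Proof.
move=> hphi el; have -> : k%:R * l = \sum_(i < k) l.
  by rewrite sumr_const card_ord mulr_natl.
by apply: cvg_big => [|i _]; [exact: add_continuous|exact: cvg_subsequence].
Qed.

Lemma cvg_near_dist (f g e : nat -> R) (l : R) : f n @[n --> \oo] --> l ->
  e n @[n --> \oo] --> (0 : R) -> (forall n, `|f n - g n| <= e n) -> g n @[n --> \oo] --> l.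
Proof.
move=> fl e0 fg; apply: (@squeeze_cvgr _ _ _ _ (fun n => f n - e n) (fun n => f n + e n)).
- by apply: nearW => n; have := fg n; rewrite ler_norml; lra.
- by rewrite -[l]subr0; apply: cvgB.
- by rewrite -[l]addr0; apply: cvgD.
Qed.

Lemma cvg0_le (f e : nat -> R) : e n @[n --> \oo] --> (0 : R) ->
  (forall n, 0 <= f n <= e n) -> f n @[n --> \oo] --> (0 : R).
Proof.
move=> e0 fe; apply: (@squeeze_cvgr _ _ _ _ (fun=> 0) e) => //.
- exact: nearW.
- exact: cvg_cst.
Qed.

End Sequences.

Section Rotundity.
Context {R : realType} {alpha : \bar R} (E : banachFunctionSpace alpha).
Implicit Types (u v w : R -> R).
Local Notation N := (norm_real E).
Local Notation car := (car_real E).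

Definition tends_to_rotund k u (us : nat -> R -> R) :=
  forall phi : 'I_k -> nat -> nat, (forall i, {homo phi i : m n / (m < n)%N}) ->
    N (fun t => u t + \sum_(i < k) us (phi i n) t) @[n --> \oo] --> (k.+1%:R : R).

Definition rotund_real k (C : set (R -> R)) := forall u (us : nat -> R -> R),
  car u -> N u = 1 -> C u -> (forall n, [/\ car (us n), N (us n) = 1 & C (us n)]) ->
  tends_to_rotund k u us -> N (fun t => us n t - u t) @[n --> \oo] --> (0 : R).

Lemma rotund_real_of k (C : set (R -> \bar R)) :
  locally_fully_rotund k E C -> rotund_real k [set u : R -> R | C (EFin \o u)].
Proof.
move=> rot u us Eu Nu Cu Eus cvgN.
apply: (rot (EFin \o u) (fun n => EFin \o us n)) => [|n|phi hphi].
- by split.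
- by have [] := Eus n.
- have := cvgN phi hphi; rewrite /norm_real.
  suff <- : (fun n => bfs_norm E (fun t => (EFin \o u) t +
      \sum_(i < k) (EFin \o us (phi i n)) t)%E) =
      (fun n => bfs_norm E (EFin \o (fun t => u t + \sum_(i < k) us (phi i n) t))) by [].
  by apply/funext => n; congr bfs_norm; apply/funext => t /=; rewrite EFinD sumEFin.
Qed.

Lemma bfs_sum (K : Type) (r : seq K) (f : K -> R -> \bar R) :
  (forall i, bfs_car E (f i)) -> bfs_car E (fun t => \sum_(i <- r) f i t)%E.
Proof.
move=> Ef; elim: r => [|i r IH].
  have -> : (fun t => \sum_(i <- [::]) f i t)%E = (EFin \o fun=> 0).
    by apply/funext => t; rewrite big_nil.
  by have [] := car_zero E.
have -> : (fun t => \sum_(j <- i :: r) f j t)%E =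
    (fun t => f i t + \sum_(j <- r) f j t)%E.
  by apply/funext => t; rewrite big_cons.
exact: bfs_add.
Qed.

Lemma rotund_real_to k : rotund_real k setT -> locally_fully_rotund k E (bfs_car E).
Proof.
move=> rot x xs [[Ex Nx] _] Exs cvgN.
have [Ex' Nx'] := car_fine Ex.
have Exs' n : car (fine \o xs n) /\ N (fine \o xs n) = 1.
  by have [[En Nn] _] := Exs n; have [? ->] := car_fine En.
have fin n := car_fin_num (Exs n).1.1.
have eqN y u : bfs_car E y -> car u -> ae_on alpha (fun t => y t = (u t)%:E) ->
    bfs_norm E y = N u.
  by move=> Ey Eu yu; have [] := car_ae_eq Eu (bfs_L0 Ey) yu.
have := rot (fine \o x) (fun n => fine \o xs n) Ex' (etrans Nx' Nx) I
  (fun n => And3 (Exs' n).1 (Exs' n).2 I).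
suff -> : (fun n => bfs_norm E (fun t => (xs n t - x t)%E)) =
    (fun n => N (fun t => (fine \o xs n) t - (fine \o x) t)).
  apply=> phi hphi; have := cvgN phi hphi.
  suff -> : (fun n => bfs_norm E (fun t => (x t + \sum_(i < k) xs (phi i n) t)%E)) =
     (fun n => N (fun t => (fine \o x) t + \sum_(i < k) (fine \o xs (phi i n)) t)) by [].
  apply/funext => n; apply: eqN.
  - apply: bfs_add => //.
    by apply: bfs_sum => i; exact: (Exs _).1.1.
  - by apply: carD => //; apply: car_sum => i _; exact: (Exs' _).1.
  - have : ae_on alpha (fun t => forall n, xs n t \is a fin_num) by apply: ae_on_forall.
    move/(ae_onS2 (car_fin_num Ex)); apply=> t _ xfin xsfin.
    rewrite EFinD -sumEFin /= fineK //; congr (_ + _)%E; apply: eq_bigr => i _.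
    by rewrite fineK.
apply/funext => n; apply: eqN.
- have -> : (fun t => xs n t - x t)%E = (fun t => xs n t + (-1)%:E * x t)%E.
    by apply/funext => t; rewrite EFinN mulN1e.
  by apply: bfs_add; [exact: (Exs n).1.1|exact: bfs_scale].
- by apply: carB => //; exact: (Exs' n).1.
- by apply: (ae_onS2 (car_fin_num Ex) (fin n)) => t _ xf xnf; rewrite /= EFinB !fineK.
Qed.

(** Normalizing [us n] moves it by |N (us n) - 1| in norm, which tends to 0, so the hypothesis and
    the conclusion pass between the sequence and its normalization. *)
Lemma rotund_real_unnormalized k (C : set (R -> R)) :
  (forall a u, 0 < a -> C u -> C (fun t => a * u t)) -> rotund_real k C ->
  forall u us, car u -> N u = 1 -> C u -> (forall n, car (us n) /\ C (us n)) ->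
  N (us n) @[n --> \oo] --> (1 : R) -> tends_to_rotund k u us ->
  N (fun t => us n t - u t) @[n --> \oo] --> (0 : R).
Proof.
move=> CZ rot u us Eu Nu Cu Eus Nus cvgN.
(* Where [us n] has norm 0, which happens for finitely many n only, the default value [u] keeps
   [z n] on the unit sphere and in [C]. *)
pose z n := if N (us n) == 0 then u else (fun t => (N (us n))^-1 * us n t).
have Ez n : [/\ car (z n), N (z n) = 1 & C (z n)].
  rewrite /z; case: eqP => [//|/eqP N0]; have [En Cn] := Eus n; split.
  - exact: carZ.
  - by rewrite normZ // ger0_norm ?mulVf // invr_ge0 norm_ge0.
  - by apply: CZ => //; rewrite invr_gt0 lt_neqAle eq_sym N0 norm_ge0.
pose e n := N (fun t => us n t - z n t).
have Ee n : car (fun t => us n t - z n t) by apply: carB; [have [] := Eus n|have [] := Ez n].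
have e0 : e n @[n --> \oo] --> (0 : R).
  have : (fun n => `|N (us n) - 1|) n @[n --> \oo] --> (0 : R).
    by rewrite -(@normr0 R R); apply: cvg_norm; rewrite -(subrr 1); apply: cvgB => //; exact: cvg_cst.
  apply: cvg_trans; apply: near_eq_cvg.
  have : \forall n \near \oo, 0 < N (us n) by apply: (cvgr_gt 1) Nus _ ltr01.
  apply: filterS => n N0; rewrite /e /z gt_eqF //.
  have -> : (fun t => us n t - (N (us n))^-1 * us n t) =
            (fun t => (1 - (N (us n))^-1) * us n t).
    by apply/funext => t; rewrite mulrBl mul1r.
  rewrite normZ; last by have [] := Eus n.
  suff -> : `|1 - (N (us n))^-1| * N (us n) = `|N (us n) - 1| by [].
  by rewrite -{2}(gtr0_norm N0) -normrM mulrBl mulVf ?mul1r ?gt_eqF.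
have zu : N (fun t => z n t - u t) @[n --> \oo] --> (0 : R).
  apply: rot => // phi hphi.
  apply: (cvg_near_dist (cvgN phi hphi)).
    have := cvg_sum_subsequences hphi e0; rewrite mulr0; exact.
  move=> n; apply: le_trans (norm_dist _ _) _.
  - by apply: carD => //; apply: car_sum => i _; have [] := Eus (phi i n).
  - by apply: carD => //; apply: car_sum => i _; have [] := Ez (phi i n).
  - have -> : (fun t => u t + \sum_(i < k) us (phi i n) t - (u t + \sum_(i < k) z (phi i n) t)) =
      (fun t => \sum_(i < k) (us (phi i n) t - z (phi i n) t)).
      by apply/funext => t; rewrite sumrB; ring.
    exact: norm_sum.
apply: (cvg0_le (e := fun n => e n + N (fun t => z n t - u t))).
  by rewrite -[0]addr0; apply: cvgD.
move=> n; have Ezu : car (fun t => z n t - u t) by apply: carB => //; have [] := Ez n.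
rewrite norm_ge0 /=; last by apply: carB => //; have [] := Eus n.
have -> : (fun t => us n t - u t) = (fun t => (us n t - z n t) + (z n t - u t)).
  by apply/funext => t; ring.
exact: normD.
Qed.

Lemma rotund_real_sub k (C C' : set (R -> R)) : (forall u, car u -> C' u -> C u) ->
  rotund_real k C -> rotund_real k C'.
Proof.
move=> C'C rot u us Eu Nu Cu Eus; apply: rot => //; first exact: C'C.
by move=> n; have [En Nn Cn] := Eus n; split=> //; exact: C'C.
Qed.

(** All k subsequences are taken equal to the sequence itself. Since u + k u_n = (u + u_n) + (k - 1)
    u_n, the norm of u + u_n is at least that of u + k u_n minus k - 1, which tends to 2. *)
Lemma norm_pair_cvg k u (us : nat -> R -> R) : (0 < k)%N -> car u -> N u = 1 ->
  (forall n, car (us n)) -> (forall n, N (us n) = 1) -> tends_to_rotund k u us ->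
  N (fun t => u t + us n t) @[n --> \oo] --> (2 : R).
Proof.
move=> k0 Eu Nu Eus Nus cvgN.
have kR : 1 <= k%:R :> R by rewrite ler1n.
have Es n : car (fun t => u t + us n t) by exact: carD.
have := cvgN (fun=> id) (fun i m n mn => mn).
move=> cvgN'; apply: (@squeeze_cvgr _ _ _ _ (fun n =>
  N (fun t => u t + \sum_(i < k) us n t) - (k%:R - 1)) (fun=> 2)); last exact: cvg_cst.
  apply: nearW => n; apply/andP; split; last first.
    by have := normD Eu (Eus n); rewrite Nu Nus.
  rewrite lerBlDr.
  have -> : (fun t => u t + \sum_(i < k) us n t) =
      (fun t => (u t + us n t) + (k%:R - 1) * us n t).
    by apply/funext => t; rewrite sumr_const card_ord -mulr_natl; ring.
  apply: le_trans (normD (Es n) (carZ _ (Eus n))) _; rewrite lerD2l normZ // Nus mulr1.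
  by rewrite ger0_norm //; lra.
have E1 : k.+1%:R - (k%:R - 1) = 2 :> R by rewrite -natr1; ring.
by have := cvgB cvgN' (cvg_cst (k%:R - 1 : R)); rewrite E1; exact.
Qed.

Lemma rotund_real_pos k : (2 <= k)%N ->
  rotund_real k [set u : R -> R | ae_on alpha (fun t => 0 <= u t)] -> rotund_real k setT.
Proof.
move=> k2 rot u us Eu Nu _ Eus cvgN.
have Ex n : car (us n) by have [] := Eus n.
have Nx n : N (us n) = 1 by have [] := Eus n.
have k0 : (0 < k)%N by exact: leq_trans k2.
have kR : 2 <= k%:R :> R by rewrite ler_nat.
have kR0 : 0 < k%:R :> R by rewrite ltr0n.
pose U : R -> R := fun t => `|u t|; pose a n : R -> R := fun t => `|us n t|.
pose z n : R -> R := fun t => 2^-1 * `|u t + us n t|.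
have [EU NU] := car_abs Eu; rewrite Nu -/U in NU; rewrite -/U in EU.
have Ea n : car (a n) by have [] := car_abs (Ex n).
have Na n : N (a n) = 1 by have [_ ->] := car_abs (Ex n).
have Es n : car (fun t => u t + us n t) by exact: carD.
have Ez n : car (z n) by apply: carZ; have [] := car_abs (Es n).
have Nz n : N (z n) = 2^-1 * N (fun t => u t + us n t).
  have [Esa NE] := car_abs (Es n).
  by rewrite normZ // NE gtr0_norm // invr_gt0.
have Nz1 n : N (z n) <= 1.
  have := normD Eu (Ex n); rewrite Nz Nu Nx; lra.
have sum_le v vs (Ev : car v) (Evs : forall n : nat, car (vs n)) (Nv : N v <= 1)
    (Nvs : forall n, N (vs n) <= 1) (phi : 'I_k -> nat) :
    N (fun t => v t + \sum_(i < k) vs (phi i) t) <= k.+1%:R.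
  have Esum : car (fun t => \sum_(i < k) vs (phi i) t) by apply: car_sum.
  apply: le_trans (normD Ev Esum) _.
  rewrite -nat1r lerD //; apply: le_trans (norm_sum _ _) _ => //.
  apply: (@le_trans _ _ (\sum_(i < k) 1)); first by apply: ler_sum.
  by rewrite sumr_const card_ord.
have aU : N (fun t => a n t - U t) @[n --> \oo] --> (0 : R).
  apply: rot => //=; [|move=> n; split=> //|move=> phi hphi].
  - by apply: ae_on_all => t _; exact: normr_ge0.
  - by apply: ae_on_all => t _; exact: normr_ge0.
  apply: squeeze_cvgr (cvgN phi hphi) (@cvg_cst _ (k.+1%:R : R) _ _ _).
  apply: nearW => n; apply/andP; split; last by apply: sum_le => // [|m]; rewrite ?NU ?Na.
  apply: norm_le.
  - by apply: carD => //; apply: car_sum.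
  - by apply: carD => //; apply: car_sum.
  apply: ae_on_all => t _; rewrite [leRHS]ger0_norm; last first.
    by apply: addr_ge0; [exact: normr_ge0|apply: sumr_ge0 => i _; exact: normr_ge0].
  by apply: le_trans (ler_normD _ _) _; rewrite lerD2l; exact: ler_norm_sum.
have zU : N (fun t => z n t - U t) @[n --> \oo] --> (0 : R).
  apply: (@rotund_real_unnormalized k [set v : R -> R | ae_on alpha (fun t => 0 <= v t)]) => //=.
  - by move=> b v b0; apply: ae_onS => t _ v0; rewrite mulr_ge0 // ltW.
  - by apply: ae_on_all => t _; exact: normr_ge0.
  - move=> n; split=> //; apply: ae_on_all => t _.
    by rewrite mulr_ge0 // ?invr_ge0 // normr_ge0.
  - under eq_fun do rewrite Nz.
    have := cvgMl_tmp (a := 2^-1 : R) (norm_pair_cvg k0 Eu Nu Ex Nx cvgN).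
    by rewrite mulVf //; exact.
  - move=> phi hphi.
    pose e n := \sum_(i < k) N (fun t => a (phi i n) t - U t).
    have e0 : e n @[n --> \oo] --> (0 : R).
      by have := cvg_sum_subsequences hphi aU; rewrite mulr0; exact.
    (* Solving the estimate A <= (2/k) B + (k - 1 - 2/k) + e_n, proved below, for B gives this lower
       bound; its limit is (k/2)(2 + 2/k) = k + 1. *)
    apply: (@squeeze_cvgr _ _ _ _ (fun n => k%:R / 2 *
      (N (fun t => u t + \sum_(i < k) us (phi i n) t) - (k%:R - 1 - 2 / k%:R) - e n))
      (fun=> k.+1%:R)); last exact: cvg_cst.
      apply: nearW => n; apply/andP; split; last by apply: sum_le => //; rewrite NU.
      set A := N _; set B := N (fun t => U t + _).
      suff : A <= 2 / k%:R * B + ((k%:R - 1 - 2 / k%:R) + e n).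
        move=> AB; rewrite -ler_pdivlMl; last by rewrite divr_gt0.
        rewrite invf_div; lra.
      have EUz : car (fun t => U t + \sum_(i < k) z (phi i n) t).
        by apply: carD => //; apply: car_sum.
      have Eaphi i : car (fun t => a (phi i n) t - U t) by apply: carB.
      have Eabs i : car (fun t => `|a (phi i n) t - U t|) by have [] := car_abs (Eaphi i).
      (* k - 1 - 2/k = (k - 2)(k + 1)/k, which is nonnegative because k >= 2. *)
      have c0 : 0 <= k%:R - 1 - 2 / k%:R :> R.
        suff : 2 / k%:R <= 1 :> R by lra.
        by rewrite ler_pdivrMr // mul1r.
      have EcU : car (fun t => (k%:R - 1 - 2 / k%:R) * U t) by apply: carZ.
      have Esum : car (fun t => \sum_(i < k) `|a (phi i n) t - U t|) by apply: car_sum.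
      apply: (@le_trans _ _ (N (fun t => (2 / k%:R) * (U t + \sum_(i < k) z (phi i n) t) +
        ((k%:R - 1 - 2 / k%:R) * U t + \sum_(i < k) `|a (phi i n) t - U t|)))); last first.
        apply: le_trans (normD (carZ _ EUz) (carD EcU Esum)) _.
        rewrite normZ // ger0_norm ?divr_ge0 // lerD2l.
        apply: le_trans (normD EcU Esum) _; rewrite normZ // ger0_norm // NU mulr1 lerD2l.
        apply: le_trans (norm_sum _ _) _ => //; apply: ler_sum => i _.
        by have [_ ->] := car_abs (Eaphi i).
      apply: norm_le; [by apply: carD => //; apply: car_sum|
        by apply: carD; [exact: carZ|exact: carD]|].
      apply: ae_on_all => t _.
      apply: le_trans (ler_norm _).
      (* The function u is shared out in k equal parts, so that the pairs u + u_i appear with weight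
         1/k and the u_i with the remaining weight 1 - 1/k. *)
      have -> : u t + \sum_(i < k) us (phi i n) t =
        \sum_(i < k) (k%:R^-1 * (u t + us (phi i n) t) + (1 - k%:R^-1) * us (phi i n) t).
        rewrite big_split /= -!mulr_sumr big_split /= sumr_const card_ord -mulr_natl.
        by field; rewrite gt_eqF.
      have -> : 2 / k%:R * (U t + \sum_(i < k) z (phi i n) t) + ((k%:R - 1 - 2 / k%:R) * U t
           + \sum_(i < k) `|a (phi i n) t - U t|) =
         \sum_(i < k) (2 / k%:R * z (phi i n) t + ((1 - k%:R^-1) * U t + `|a (phi i n) t - U t|)).
        rewrite !big_split /= -!mulr_sumr sumr_const card_ord -(mulr_natl (U t)).
        by field; rewrite gt_eqF.
      apply: le_trans (ler_norm_sum _ _ _) _; apply: ler_sum => i _.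
      apply: le_trans (ler_normD _ _) _; apply: lerD.
        rewrite normrM ger0_norm ?invr_ge0 // le_eqVlt; apply/orP; left; apply/eqP.
        by rewrite /z; field; rewrite gt_eqF.
      have k1 : 0 <= 1 - k%:R^-1 :> R by rewrite subr_ge0 invf_le1 //; lra.
      rewrite normrM ger0_norm //.
      apply: (@le_trans _ _ ((1 - k%:R^-1) * (U t + `|a (phi i n) t - U t|))).
        by apply: ler_wpM2l => //; rewrite -[leLHS]/(a (phi i n) t); have := ler_norm (a (phi i n) t - U t); lra.
      by rewrite mulrDr lerD2l ler_piMl ?normr_ge0 //.
    have E1 : k%:R / 2 * (k.+1%:R - (k%:R - 1 - 2 / k%:R) - 0) = k.+1%:R :> R.
      by rewrite -natr1; field; rewrite gt_eqF.
    have := cvgMl_tmp (a := k%:R / 2 : R)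
      (cvgB (cvgB (cvgN _ hphi) (cvg_cst (k%:R - 1 - 2 / k%:R : R))) e0).
    by rewrite E1; exact.
(* |u_n - u| = 2 max(|u|, |u_n|) - 2 z_n, and the maximum is at most |u| + | |u_n| - |u| |; hence
   both factors 2. *)
apply: (cvg0_le (e := fun n => 2 * N (fun t => z n t - U t) + 2 * N (fun t => a n t - U t))).
  have := cvgD (cvgMl_tmp (a := 2 : R) zU) (cvgMl_tmp (a := 2 : R) aU).
  by rewrite !mulr0 addr0; exact.
move=> n; have E1 : car (fun t => us n t - u t) by apply: carB.
have [E2 N2] : car (fun t => `|z n t - U t|) /\ _ := car_abs (carB (Ez n) EU).
have [E3 N3] : car (fun t => `|a n t - U t|) /\ _ := car_abs (carB (Ea n) EU).
rewrite norm_ge0 //=.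
rewrite -N2 -N3 -[X in X * N _ + _]gtr0_norm // -[X in _ + X * N _]gtr0_norm // -!normZ //.
apply: le_trans (normD (carZ _ E2) (carZ _ E3)); apply: norm_le => //.
  by apply: carD; exact: carZ.
apply: ae_on_all => t _; rewrite [leRHS]ger0_norm; last first.
  by rewrite addr_ge0 // mulr_ge0 // normr_ge0.
(* |b - a| + |b + a| = 2 max(|a|, |b|) *)
rewrite /z /a /U.
have := ler_norm (2^-1 * `|u t + us n t| - `|u t|).
have := ler_norm (`|us n t| - `|u t|).
have := ler_norm (`|u t| - `|us n t|).
rewrite (distrC `|u t|) -(normrN (_ - `|u t|)) opprB.
have := normrN (2^-1 * `|u t + us n t| - `|u t|); rewrite opprB => <-.
have := ler_norm (`|u t| - 2^-1 * `|u t + us n t|).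
have [?|?] := ger0P (us n t - u t); have [?|?] := ger0P (u t + us n t);
have [?|?] := ger0P (u t); have [?|?] := ger0P (us n t); lra.
Qed.

End Rotundity.

(** * Distribution functions and rearrangements *)

Lemma eq_ge0_ereal (R : realType) (a b : \bar R) : (0 <= a)%E -> (0 <= b)%E ->
  (forall l : R, 0 <= l -> (l%:E < a)%E = (l%:E < b)%E) -> a = b.
Proof.
have key (c d : \bar R) : (0 <= d)%E ->
    (forall l : R, 0 <= l -> (l%:E < c)%E -> (l%:E < d)%E) -> (c <= d)%E.
  move=> d0 cd; rewrite leNgt; apply/negP => dc.
  case: d d0 cd dc => [r d0 cd rc|_ _|//]; last by rewrite ltNge leey.
  by have := cd r d0 rc; rewrite ltxx.
by move=> a0 b0 ab; apply: le_anti; apply/andP; split; apply: key => // l l0; rewrite ab.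
Qed.

Section Rearrangement.
Context {R : realType} (alpha : \bar R).
Local Notation mu := (@lebesgue_measure R).
Local Notation I := (dom alpha).
Implicit Types (x y : R -> \bar R).

Lemma lebesgue_measure_dom (a : \bar R) : (0 <= a)%E -> mu (dom a) = a.
Proof.
move=> a0; rewrite dom_itv lebesgue_measure_itv /=; case: a a0 => [r||] //=.
  by rewrite lee_fin lte_fin => r0; case: ltgtP r0 => [_ _|//|<- //]; rewrite oppr0 -EFinD addr0.
by move=> _; rewrite ltry.
Qed.

(** [dom] is used with any endpoint: the initial intervals [dom a] with a <= alpha are the
    superlevel sets of rearrangements. *)
Lemma dom_setI (a : \bar R) : (a <= alpha)%E -> I `&` [set t | (t%:E < a)%E] = dom a.
Proof.
move=> a_le; apply/seteqP; split=> t; first by move=> [[t0 _] /= ta].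
by move=> [t0 ta]; split=> //; split=> //; exact: lt_le_trans a_le.
Qed.

Lemma le_measure_ae (A B : set R) : measurable A -> measurable B ->
  A `<=` I -> ae_on alpha (fun t => A t -> B t) -> (mu A <= mu B)%E.
Proof.
move=> mA mB AI [Z [mZ Z0 subZ]]; rewrite -(@measureU0 _ _ _ mu B Z mB mZ Z0).
apply: le_measure; rewrite ?inE //; first exact: measurableU.
move=> t At; have [Bt|nBt] := pselect (B t); [by left|right; apply: subZ => /=].
by move=> h; apply: nBt; apply: h => //; exact: AI.
Qed.

Lemma measurable_abs_level x (l : R) : measurable_fun I x ->
  measurable (I `&` [set s | (l%:E < `|x s|)%E]).
Proof.
move=> mx; apply: emeasurable_fun_o_infty; first exact: measurable_dom.
by apply: measurableT_comp => //; exact: abse_measurable.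
Qed.

Lemma distr_le_ae x y (l : R) : measurable_fun I x -> measurable_fun I y ->
  ae_on alpha (fun t => (`|x t| <= `|y t|)%E) -> (distr alpha x l <= distr alpha y l)%E.
Proof.
move=> mx my xy; apply: le_measure_ae; try exact: measurable_abs_level.
  exact: subIsetl.
by apply: ae_onS xy => t It xyt [_ /= lx]; split=> //=; exact: lt_le_trans xyt.
Qed.

Lemma distr_nonincreasing x (l l' : R) : measurable_fun I x -> l <= l' ->
  (distr alpha x l' <= distr alpha x l)%E.
Proof.
move=> mx ll'; apply: le_measure; rewrite ?inE; try exact: measurable_abs_level.
by apply: setIS => t /=; apply: le_lt_trans; rewrite lee_fin.
Qed.

Lemma distr_le_alpha x (l : R) : (0 <= alpha)%E -> measurable_fun I x ->
  (distr alpha x l <= alpha)%E.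
Proof.
move=> alpha0 mx; rewrite -[leRHS](lebesgue_measure_dom alpha0).
by apply: le_measure; rewrite ?inE; [exact: measurable_abs_level|exact: measurable_dom|
  exact: subIsetl].
Qed.

(** Continuity of the measure from below: {|x| > l} is the increasing union of the sets {|x| > l +
    1/(n+1)}. *)
Lemma distr_right_continuous x (l t : R) : measurable_fun I x ->
  (t%:E < distr alpha x l)%E -> exists2 l', l < l' & (t%:E < distr alpha x l')%E.
Proof.
move=> mx tx.
pose F n := I `&` [set s | ((l + n.+1%:R^-1)%:E < `|x s|)%E].
have mF n : measurable (F n) by exact: measurable_abs_level.
have UF : \bigcup_n F n = I `&` [set s | (l%:E < `|x s|)%E].
  apply/seteqP; split=> s.
    move=> [n _ [Is /= ls]]; split=> //=; apply: lt_trans ls.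
    by rewrite lte_fin ltrDl invr_gt0.
  move=> [Is /= ls].
  have [d d0 ld] : exists2 d : R, 0 < d & ((l + d)%:E < `|x s|)%E.
    case: (`|x s|)%E ls => [r||] //.
    - by rewrite lte_fin => lr; exists ((r - l) / 2); rewrite ?lte_fin; lra.
    - by exists 1 => //; rewrite ltry.
  exists (Num.truncn d^-1) => //; split=> //=; apply: lt_trans ld.
  rewrite lte_fin ltrD2l invf_plt ?posrE //.
  exact: truncnS_gt.
apply: contrapT => noex.
have : (distr alpha x l <= t%:E)%E.
  rewrite /distr -UF.
  have mUF : measurable (\bigcup_n F n) by exact: bigcupT_measurable.
  have cvF := @nondecreasing_cvg_mu _ _ _ mu F mF mUF.
  apply: (lee_cvg_to (cvF _) (@cvg_cst _ (t%:E : \bar R) _ _ _)).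
    move=> m n mn; apply/subsetPset; apply: setIS => s /=; apply: le_lt_trans.
    by rewrite lee_fin lerD2l lef_pV2 ?posrE // ler_nat.
  apply: nearW => n; rewrite leNgt; apply/negP => tF; apply: noex.
  by exists (l + n.+1%:R^-1); rewrite // ltrDl invr_gt0.
by rewrite leNgt tx.
Qed.

Lemma rearrangement_ge0 x (t : R) : (0 <= rearrangement alpha x t)%E.
Proof. by apply: le_ereal_inf_tmp => _ [l [l0 _] <-]; rewrite lee_fin ltW. Qed.

(** Right continuity of [distr] makes this an equivalence between strict inequalities. Later facts
    about rearrangements are read off from it level by level instead of from the infimum. *)
Lemma rearrangement_gt x (l t : R) : measurable_fun I x -> 0 <= l ->
  (l%:E < rearrangement alpha x t)%E = (t%:E < distr alpha x l)%E.
Proof.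
move=> mx l0; apply/idP/idP; last first.
  move=> /(distr_right_continuous mx)[l' ll' tl'].
  apply: (@lt_le_trans _ _ l'%:E); first by rewrite lte_fin.
  apply: le_ereal_inf_tmp => _ [m [m0 dm] <-]; rewrite lee_fin leNgt; apply/negP => ml'.
  have := lt_le_trans tl' (distr_nonincreasing mx (ltW ml')).
  by rewrite ltNge dm.
(* The infimum ranges over positive levels while [l] may be 0, hence the detour through [l + e]. *)
rewrite !ltNge; apply: contra => dl; apply/lee_addgt0Pr => e e0.
apply: ereal_inf_lbound; exists (l + e) => //; split; first exact: ltr_wpDl.
by apply: le_trans dl; apply: distr_nonincreasing => //; rewrite lerDl ltW.
Qed.

(** For l >= 0 the superlevel set is the initial interval [dom (distr alpha x l)]; for l < 0 it is
    all of I, rearrangements being nonnegative. *)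
Lemma measurable_rearrangement x : (0 <= alpha)%E -> measurable_fun I x ->
  measurable_fun I (rearrangement alpha x).
Proof.
move=> alpha0 mx; apply: (measurability _ (ErealGenOInfty.measurableE R)).
move=> /= _ [_ [l ->]] <-; rewrite preimage_itvoy.
have [l0|l0] := leP 0 l.
  rewrite (_ : _ `&` _ = dom (distr alpha x l)); first exact: measurable_dom.
  rewrite -(dom_setI (distr_le_alpha _ alpha0 mx)); apply/seteqP.
  by split=> t /= [It]; rewrite (rearrangement_gt _ mx).
rewrite (_ : _ `&` _ = I); first exact: measurable_dom.
apply/seteqP; split=> t; first by case.
move=> It; split=> //=; apply: lt_le_trans (rearrangement_ge0 _ _).
by rewrite lte_fin.
Qed.

Lemma distr_rearrangement x (l : R) : (0 <= alpha)%E -> measurable_fun I x -> 0 <= l ->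
  distr alpha (rearrangement alpha x) l = distr alpha x l.
Proof.
move=> alpha0 mx l0; rewrite {1}/distr.
rewrite -[RHS]lebesgue_measure_dom ?measure_ge0 //.
congr (mu _); rewrite -(dom_setI (distr_le_alpha _ alpha0 mx)); apply/seteqP.
by split=> t /= [It]; rewrite gee0_abs ?rearrangement_ge0 // (rearrangement_gt _ mx).
Qed.

Lemma rearrangement_le x y (t : R) : measurable_fun I x -> measurable_fun I y ->
  ae_on alpha (fun s => (`|x s| <= `|y s|)%E) ->
  (rearrangement alpha x t <= rearrangement alpha y t)%E.
Proof.
move=> mx my xy; rewrite leNgt; apply/negP => yx.
have yge0 := rearrangement_ge0 y t.
have [r ry] : exists r, rearrangement alpha y t = r%:E.
  case: (rearrangement alpha y t) yge0 yx => [r _ _|_|//]; first by exists r.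
  by rewrite ltNge leey.
have r0 : 0 <= r by move: yge0; rewrite ry lee_fin.
move: yx; rewrite ry rearrangement_gt // => /lt_le_trans/(_ (distr_le_ae r mx my xy)).
by rewrite -rearrangement_gt // ry ltxx.
Qed.

Lemma rearrangementZ (a : R) x (t : R) : 0 < a -> measurable_fun I x ->
  rearrangement alpha (fun s => a%:E * x s)%E t = (a%:E * rearrangement alpha x t)%E.
Proof.
move=> a0 mx; apply: eq_ge0_ereal.
- exact: rearrangement_ge0.
- by rewrite mule_ge0 ?rearrangement_ge0 // lee_fin ltW.
move=> l l0.
have max : measurable_fun I (fun s => a%:E * x s)%E by exact: emeasurable_funM.
have scale (r : \bar R) : (l%:E < a%:E * r)%E = ((l / a)%:E < r)%E.
  by rewrite -(lte_pdivrMl _ _ a0) -EFinM mulrC.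
rewrite rearrangement_gt //; apply: etrans; last exact: esym (scale _).
rewrite rearrangement_gt ?divr_ge0 // ?(ltW a0) //.
congr (_ < _)%E; rewrite /distr; congr (mu (_ `&` _)); apply/seteqP.
have aE : `|a%:E|%E = a%:E by rewrite gee0_abs // lee_fin ltW.
split=> s /=; rewrite abseM aE => h.
  exact: etrans (esym (scale _)) h.
exact: etrans (scale _) h.
Qed.

End Rearrangement.

(** * Indicators, Chebyshev's inequality and dominated convergence in a symmetric space *)

Section SymmetricSpace.
Context {R : realType} {alpha : \bar R} (E : banachFunctionSpace alpha).
Hypothesis alpha_gt0 : (0 < alpha)%E.
Hypothesis symE : symmetric_space E.
Implicit Types (u v w : R -> R).
Local Notation mu := (@lebesgue_measure R).
Local Notation I := (dom alpha).
Local Notation N := (norm_real E).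
Local Notation car := (car_real E).
Let alpha_ge0 : (0 <= alpha)%E := ltW alpha_gt0.

Definition rdistr u (l : R) : \bar R := distr alpha (EFin \o u) l.
(** The rearrangement can be infinite on a null set, such as {0} when [u] is unbounded; [fine] puts
    0 there, so comparisons of [star] with levels hold almost everywhere only. *)
Definition star u (t : R) : R := fine (rearrangement alpha (EFin \o u) t).

Lemma rdistrE u l : rdistr u l = mu (I `&` [set s | l < `|u s|]).
Proof. by congr (mu (_ `&` _)); apply/seteqP; split=> s /=; rewrite lte_fin. Qed.

Lemma measurable_rlevel u l : measurable_fun I u -> measurable (I `&` [set s | l < `|u s|]).
Proof.
move=> /measurable_EFinP mu; have := measurable_abs_level l mu.
by congr (measurable (_ `&` _)); apply/seteqP; split=> s /=; rewrite lte_fin.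
Qed.

Lemma rdistr_le u v l : measurable_fun I u -> measurable_fun I v ->
  ae_on alpha (fun t => `|u t| <= `|v t|) -> (rdistr u l <= rdistr v l)%E.
Proof.
move=> /measurable_EFinP mu /measurable_EFinP mv uv; apply: distr_le_ae => //.
Qed.

Lemma rdistr_le_alpha u l : measurable_fun I u -> (rdistr u l <= alpha)%E.
Proof. by move=> /measurable_EFinP mu; exact: distr_le_alpha. Qed.

Lemma car_rearrangement x : bfs_car E x ->
  bfs_car E (rearrangement alpha x) /\ bfs_norm E (rearrangement alpha x) = bfs_norm E x.
Proof.
move=> Ex; have mx := bfs_L0 Ex; apply: symE => //.
  exact: measurable_rearrangement.
by move=> l l0; exact: distr_rearrangement.
Qed.

Lemma car_star u : car u -> car (star u) /\ N (star u) = N u.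
Proof.
move=> Eu; have [Er Nr] := car_rearrangement Eu.
by have [? NE] := car_fine Er; split=> //; rewrite -[RHS]Nr.
Qed.

Lemma star_EFin u : car u ->
  ae_on alpha (fun t => (star u t)%:E = rearrangement alpha (EFin \o u) t).
Proof.
move=> Eu; have [/car_fin_num fin _] := car_rearrangement Eu.
by apply: ae_onS fin => t _ ft; rewrite fineK.
Qed.

Lemma star_ge0 u t : 0 <= star u t.
Proof. by apply: fine_ge0; exact: rearrangement_ge0. Qed.

Lemma star_gt u : car u ->
  ae_on alpha (fun t => forall l, 0 <= l -> (l < star u t) = (t%:E < rdistr u l)%E).
Proof.
move=> Eu; apply: ae_onS (star_EFin Eu) => t _ ut l l0.
by rewrite -lte_fin ut rearrangement_gt //; exact: bfs_L0 Eu.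
Qed.

Lemma star_le u v : car u -> car v -> ae_on alpha (fun t => `|u t| <= `|v t|) ->
  ae_on alpha (fun t => star u t <= star v t).
Proof.
move=> Eu Ev uv; apply: (ae_onS2 (star_EFin Eu) (star_EFin Ev)) => t _ ut vt.
rewrite -lee_fin ut vt; apply: rearrangement_le.
- exact: bfs_L0 Eu.
- exact: bfs_L0 Ev.
- by apply: ae_onS uv => s _; rewrite lee_fin.
Qed.

Lemma car_sym u v : measurable_fun I u -> car v ->
  (forall l, 0 <= l -> rdistr u l = rdistr v l) -> car u /\ N u = N v.
Proof. by move=> /measurable_EFinP mu Ev uv; exact: symE. Qed.

Lemma rdistr_star u l : car u -> 0 <= l -> rdistr (star u) l = rdistr u l.
Proof.
move=> Eu l0; have mu := car_measurable Eu.
have [/car_measurable ms _] := car_star Eu.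
have mr : measurable_fun I (rearrangement alpha (EFin \o u)).
  by apply: measurable_rearrangement => //; exact/measurable_EFinP.
rewrite /rdistr -[RHS]distr_rearrangement //; last exact/measurable_EFinP.
apply: le_anti; apply/andP; split; apply: distr_le_ae => //; try exact/measurable_EFinP.
  by apply: ae_onS (star_EFin Eu) => t _ <-.
by apply: ae_onS (star_EFin Eu) => t _ <-.
Qed.

Lemma rdistr_indic (B : set R) (c l : R) : 0 < c -> 0 <= l ->
  rdistr (fun t => c * \1_B t) l = (if l < c then mu (I `&` B) else 0%E).
Proof.
move=> c0 l0; rewrite rdistrE; case: ifPn => lc.
  congr (mu _); apply/seteqP; split=> s [Is /=].
    rewrite indicE; case: (boolP (s \in B)) => [/set_mem //|_].
    by rewrite mulr0 normr0 ltNge l0.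
  by move=> Bs; split=> //=; rewrite indicE mem_set // mulr1 gtr0_norm.
rewrite (_ : _ `&` _ = set0) ?measure0 // -subset0 => s [_ /=]; rewrite indicE.
case: (_ \in _); rewrite ?mulr0 ?normr0 ?mulr1 ?gtr0_norm //.
  by move=> lc'; rewrite lc' in lc.
by rewrite ltNge l0.
Qed.

Lemma rdistr_indic1 (B : set R) (l : R) : 0 <= l ->
  rdistr \1_B l = (if l < 1 then mu (I `&` B) else 0%E).
Proof.
move=> l0; rewrite -(rdistr_indic _ _ l0) //; congr (rdistr _ l).
by apply/funext => t; rewrite mul1r.
Qed.

Lemma car_indic_sub (A B : set R) : measurable A -> A `<=` B -> car \1_B -> car (\1_A : R -> R).
Proof.
move=> mA AB EB; have [] // := @car_solid _ _ E (\1_A) (\1_B) _ EB.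
apply: ae_on_all => t _; rewrite !indicE; case: (boolP (t \in A)) => [/set_mem At|_].
  by rewrite mem_set //; exact: AB.
by rewrite normr0.
Qed.

Lemma dom_sub (a : \bar R) : (a <= alpha)%E -> dom a `<=` I.
Proof. by move=> aalpha t [t0 ta]; split=> //; exact: lt_le_trans aalpha. Qed.

Lemma dom_setIr (a : \bar R) : (a <= alpha)%E -> I `&` dom a = dom a.
Proof. by move=> /dom_sub/setIidr. Qed.

(** The strictly positive element x of E has a level l > 0 with d_x(l) > 0, and l times the
    indicator of [0, b) lies below the rearrangement of x as soon as b <= d_x(l). *)
Lemma car_indic_small : exists2 b : R, 0 < b & car (\1_(I `&` dom b%:E) : R -> R).
Proof.
have [x Ex x0] := bfs_pos E; have mx := bfs_L0 Ex.
have d0 : (0%:E < distr alpha x 0)%E.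
  apply: lt_le_trans alpha_gt0 _; rewrite -[leLHS](lebesgue_measure_dom alpha_ge0).
  apply: (@le_measure_ae _ alpha) => //; [exact: measurable_dom|exact: measurable_abs_level|].
  by apply: ae_onS x0 => t It xt _; split=> //=; rewrite gee0_abs // ltW.
have [l l0 dl] := distr_right_continuous mx d0.
have [b b0 bd] : exists2 b : R, 0 < b & (b%:E <= distr alpha x l)%E.
  case: (distr alpha x l) dl => [r||//]; first by rewrite lte_fin => r0; exists r.
  by move=> _; exists 1 => //; exact: leey.
exists b => //; have [Er _] := car_rearrangement Ex.
have [Ef _] := car_fine Er.
have [] // := @car_solid _ _ E (\1_(I `&` dom b%:E)) (fun t => l^-1 * (fine \o rearrangement alpha x) t) _ (carZ _ Ef).
  by apply: measurable_indic; apply: measurableI; exact: measurable_dom.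
apply: ae_onS (car_fin_num Er) => t It ft; rewrite indicE.
case: (boolP (t \in _)) => [/set_mem[_ [t0 tb]]|_]; last by rewrite normr0 normr_ge0.
rewrite normr1 normrM ger0_norm ?invr_ge0 ?(ltW l0) // ler_pdivlMl // mulr1 /=.
apply: le_trans (ler_norm _); rewrite -lee_fin fineK //; apply: ltW.
by rewrite rearrangement_gt ?(ltW l0) //; exact: lt_le_trans bd.
Qed.

(** Induction over blocks of length b: the next block, cut off at alpha, has measure at most b,
    hence is equimeasurable with an initial interval inside [0, b), whose indicator is in E. *)
Lemma car_indic_initial (a : R) : car (\1_(I `&` dom a%:E) : R -> R).
Proof.
have [b b0 Eb] := car_indic_small.
suff key (n : nat) : car (\1_(I `&` dom (n%:R * b)%:E) : R -> R).
  apply: car_indic_sub (key (Num.truncn `|a / b|).+1).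
    by apply: measurableI; exact: measurable_dom.
  apply: setIS => t [t0 ta]; split=> //; apply: lt_trans ta _.
  rewrite lte_fin -ltr_pdivrMr //; apply: le_lt_trans (ler_norm _) _.
  exact: truncnS_gt.
elim: n => [|n IH].
  apply: car_indic_sub Eb; first by apply: measurableI; exact: measurable_dom.
  apply: setIS => t [t0]; rewrite mul0r lte_fin => t0'; split=> //.
  by have := le_lt_trans t0 t0'; rewrite ltxx.
pose C := I `&` (dom (n.+1%:R * b)%:E `\` dom (n%:R * b)%:E).
have mC : measurable C.
  by apply: measurableI; [exact: measurable_dom|apply: measurableD; exact: measurable_dom].
have muC : (mu C <= b%:E)%E.
  apply: (@le_trans _ _ (mu `[n%:R * b, n.+1%:R * b[%classic)).
    apply: le_measure; rewrite ?inE //.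
    move=> t [It [[t0 /=]]]; rewrite /dom /= in_itv /= !lte_fin => -> /not_andP[//|/negP].
    by rewrite -leNgt => ->.
  rewrite lebesgue_measure_itv /= lte_fin ltr_pM2r // ltr_nat ltnSn -EFinB lee_fin.
  by rewrite -mulrBl -natr1 addrAC subrr add0r mul1r.
have muCalpha : (mu C <= alpha)%E.
  rewrite -[leRHS](lebesgue_measure_dom alpha_ge0); apply: le_measure; rewrite ?inE //.
    exact: measurable_dom.
  exact: subIsetl.
have EmuC : car (\1_(dom (mu C)) : R -> R).
  apply: car_indic_sub Eb; first exact: measurable_dom.
  by rewrite -(dom_setIr muCalpha); apply: setIS => t [t0 tC]; split=> //; exact: lt_le_trans muC.
have EC : car (\1_C : R -> R).
  apply: (car_sym _ EmuC _).1; first exact: measurable_indic.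
  move=> l l0; rewrite !rdistr_indic1 // dom_setIr // lebesgue_measure_dom ?measure_ge0 //.
  by rewrite (setIidr (@subIsetl _ _ _)).
have [] // := @car_solid _ _ E (\1_(I `&` dom (n.+1%:R * b)%:E)) _ _ (carD IH EC).
  by apply: measurable_indic; apply: measurableI; exact: measurable_dom.
apply: ae_on_all => t It; rewrite !indicE [leRHS]ger0_norm; last by rewrite addr_ge0.
case: (boolP (t \in _)) => [/set_mem[_ tn]|_]; last by rewrite normr0 addr_ge0.
rewrite normr1; have [tn'|tn'] := pselect (dom (n%:R * b)%:E t).
  by rewrite (_ : (t \in I `&` _) = true) ?lerDl //; exact: mem_set.
by rewrite (_ : (t \in C) = true) ?lerDr //; apply: mem_set.
Qed.

Lemma car_indic (B : set R) : measurable B -> B `<=` I -> (mu B < +oo)%E ->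
  car (\1_B : R -> R) /\ N \1_B = N \1_(dom (mu B)).
Proof.
move=> mB BI muB; have muBalpha : (mu B <= alpha)%E.
  rewrite -[leRHS](lebesgue_measure_dom alpha_ge0); apply: le_measure; rewrite ?inE //.
  exact: measurable_dom.
have muBfin : mu B \is a fin_num by rewrite ge0_fin_numE ?measure_ge0.
apply: car_sym; first exact: measurable_indic.
  have := car_indic_initial (fine (mu B)).
  by rewrite fineK // dom_setIr.
move=> l l0; rewrite !rdistr_indic1 // dom_setIr // lebesgue_measure_dom ?measure_ge0 //.
by rewrite (setIidr BI).
Qed.

Lemma car_indic_dom (a : R) : (a%:E <= alpha)%E -> car (\1_(dom a%:E) : R -> R).
Proof. by move=> aalpha; rewrite -(dom_setIr aalpha); exact: car_indic_initial. Qed.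

Lemma norm_indic_gt0 (a : R) : 0 < a -> (a%:E <= alpha)%E -> 0 < N \1_(dom a%:E).
Proof.
move=> a0 aalpha; have Ea := car_indic_dom aalpha.
rewrite lt_neqAle norm_ge0 // andbT eq_sym; apply/eqP => /(bfs_norm_eq0 Ea) z.
have : (mu (dom a%:E) <= mu set0)%E.
  apply: (@le_measure_ae _ alpha) => //; [exact: measurable_dom|exact: dom_sub|].
  apply: ae_onS z => t _ /= /eqP; rewrite eqe indicE => + ta.
  by rewrite mem_set // oner_eq0.
by rewrite measure0 lebesgue_measure_dom ?lee_fin ?(ltW a0) // leNgt a0.
Qed.

(** [star u] has the norm of [u] and exceeds [e] almost everywhere on [0, eta), because eta <=
    d_u(e). *)
Lemma norm_chebyshev u (eta e : R) : car u -> 0 <= e -> (eta%:E <= rdistr u e)%E ->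
  e * N \1_(dom eta%:E) <= N u.
Proof.
move=> Eu e0 etau; have [Es <-] := car_star Eu.
have etaalpha : (eta%:E <= alpha)%E.
  by apply: le_trans etau _; apply: rdistr_le_alpha; exact: car_measurable Eu.
have Eeta := car_indic_dom etaalpha.
rewrite -[X in X * _]ger0_norm // -normZ //; apply: norm_le => //; first exact: carZ.
apply: ae_onS (star_gt Eu) => t _ ut; rewrite indicE.
case: (boolP (t \in _)) => [/set_mem[_ teta]|_]; last by rewrite mulr0 normr0.
rewrite mulr1 !ger0_norm ?star_ge0 //; apply: ltW; rewrite ut //.
exact: lt_le_trans etau.
Qed.

Lemma norm_cvg0_measure (us : nat -> R -> R) (e eta : R) : (forall n, car (us n)) ->
  N (us n) @[n --> \oo] --> (0 : R) -> 0 < e -> 0 < eta ->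
  \forall n \near \oo, (rdistr (us n) e < eta%:E)%E.
Proof.
move=> Eus us0 e0 eta0; have [etaalpha|etaalpha] := leP eta%:E alpha; last first.
  apply: nearW => n; apply: le_lt_trans etaalpha; apply: rdistr_le_alpha.
  exact: car_measurable (Eus n).
have pos : 0 < e * N \1_(dom eta%:E) by rewrite mulr_gt0 // norm_indic_gt0.
have lt_us : \forall n \near \oo, N (us n) < e * N \1_(dom eta%:E) by exact: (cvgr_lt 0) us0 _ pos.
apply: filterS lt_us => n usn.
rewrite ltNge; apply/negP => etau.
have := lt_le_trans usn (norm_chebyshev (Eus n) (ltW e0) etau).
by rewrite ltxx.
Qed.

Hypothesis OC : order_continuous E.

(** If the level set A had infinite measure, so would each A minus [0, n). These sets are
    equimeasurable with A, so their indicators have constant norm, yet they decrease to the empty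
    set; order continuity then makes A null. *)
Lemma rdistr_lty u l : car u -> 0 < l -> (rdistr u l < +oo)%E.
Proof.
move=> Eu l0; rewrite ltey; apply/eqP => dinf.
pose A := I `&` [set s | l < `|u s|].
have mA : measurable A by apply: measurable_rlevel; exact: car_measurable Eu.
have muA : mu A = +oo%E by rewrite -dinf rdistrE.
pose An n := A `\` dom n%:R%:E.
have mAn n : measurable (An n) by apply: measurableD => //; exact: measurable_dom.
have AnA n : An n `<=` A by exact: subDsetl.
have muAn n : mu (An n) = +oo%E.
  apply/eqP; apply: contraT; rewrite -ltey => fin.
  suff : (mu A < +oo)%E by rewrite muA.
  apply: (@le_lt_trans _ _ (mu (An n `|` dom n%:R%:E))).
    apply: le_measure; rewrite ?inE //.
      exact: (measurableU _ _ (mAn n) (measurable_dom _)).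
    move=> t At; have [|nt] := pselect (dom n%:R%:E t); first by right.
    by left; split.
  apply: (le_lt_trans (@measureU2 _ _ _ mu _ _ (mAn n) (measurable_dom _))).
  have mud : (mu (dom n%:R%:E) < +oo)%E by rewrite lebesgue_measure_dom ?ltry // lee_fin.
  exact: lte_add_pinfty.
have mind B : measurable B -> measurable_fun I (fun t => l * \1_B t : R).
  by move=> mB; apply: measurable_funM; [exact: measurable_cst|exact: measurable_indic].
have EA : car (fun t => l * \1_A t).
  have [] // := @car_solid _ _ E (fun t => l * \1_A t) u (mind _ mA) Eu.
  apply: ae_on_all => t It; rewrite indicE; case: (boolP (t \in A)) => [/set_mem[_ lu]|_].
    by rewrite mulr1 gtr0_norm // ltW.
  by rewrite mulr0 normr0.
have EAn n : car (fun t => l * \1_(An n) t) /\ N (fun t => l * \1_(An n) t) = N (fun t => l * \1_A t).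
  apply: car_sym => //; first exact: mind.
  move=> l' l'0; rewrite !rdistr_indic // !(setIidr _) ?muAn ?muA //.
    exact: subIsetl.
  by apply: subset_trans (AnA n) _; exact: subIsetl.
have : N (fun t => l * \1_(An n) t) @[n --> \oo] --> (0 : R).
  apply: (order_continuous_real OC EA) => [n|n|]; first by have [] := EAn n.
    apply: ae_on_all => t It; rewrite ger0_norm; last by rewrite mulr_ge0 // ltW.
    rewrite mulr_ge0 ?(ltW l0) //= ler_pM2l // !indicE.
    case: (boolP (t \in An n)) => [/set_mem/AnA At|_]; last by [].
    by rewrite mem_set.
  apply: ae_on_all => t [t0 _]; apply: (@cvg_near_cst _ R 0).
  exists (Num.truncn t).+1 => // n /= tn; rewrite indicE memNset ?mulr0 //.
  move=> [_]; apply; split=> //; rewrite lte_fin.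
  by apply: lt_le_trans (truncnS_gt t) _; rewrite ler_nat.
have -> : (fun n => N (fun t => l * \1_(An n) t)) = (fun=> N (fun t => l * \1_A t)).
  by apply/funext => n; have [] := EAn n.
move=> cvgNA; have NA0 : N (fun t => l * \1_A t) = 0.
  by apply: (cvg_unique (@norm_hausdorff _ R) _ cvgNA); exact: cvg_cst.
have : (mu A <= mu set0)%E.
  apply: (@le_measure_ae _ alpha) => //; first exact: subIsetl.
  apply: ae_onS (bfs_norm_eq0 EA NA0) => t _ /= /eqP; rewrite eqe indicE => + At.
  by rewrite mem_set // mulr1 gt_eqF.
by rewrite muA measure0.
Qed.

(** The hypotheses say that the rearrangements of the [us m] lie below that of [u] and converge to
    it pointwise, so order continuity applies to the differences. The functions [us m] themselves
    need not converge to [u]. *)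
Lemma norm_cvg_rdistr (us : nat -> R -> R) u : car u -> (forall m, car (us m)) ->
  (forall m l, 0 <= l -> (rdistr (us m) l <= rdistr u l)%E) ->
  (forall l t : R, 0 <= l -> (t%:E < rdistr u l)%E ->
    \forall m \near \oo, (t%:E < rdistr (us m) l)%E) ->
  N (us m) @[m --> \oo] --> N u.
Proof.
move=> Eu Eus leu cvgu.
have [Es Ns] := car_star Eu.
have Ems m : car (star (us m)) by have [] := car_star (Eus m).
have aes : ae_on alpha (fun t => forall m l, 0 <= l ->
    (l < star (us m) t) = (t%:E < rdistr (us m) l)%E).
  by apply: ae_on_forall => m; exact: star_gt.
have les m : ae_on alpha (fun t => star (us m) t <= star u t).
  apply: (ae_onS2 (star_gt Eu) aes) => t _ ut ust; rewrite leNgt; apply/negP => uus.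
  have := uus; rewrite ust ?star_ge0 // => /lt_le_trans/(_ (leu m _ (star_ge0 _ _))).
  by rewrite -ut ?star_ge0 // ltxx.
have : N (fun t => star u t - star (us m) t) @[m --> \oo] --> (0 : R).
  apply: (order_continuous_real OC Es) => [m|m|].
  - exact: carB.
  - apply: ae_onS (les m) => t _ ust; rewrite subr_ge0 ust /= ger0_norm ?star_ge0 //.
    by rewrite gerBl star_ge0.
  - have aele : ae_on alpha (fun t => forall m, star (us m) t <= star u t) by exact: ae_on_forall.
    apply: (ae_onS2 (star_gt Eu) (ae_onS2 aes aele (fun t _ => @conj _ _))) => t _ ut [ust usle].
    apply/cvgrPdist_lt => e e0.
    have [eu|eu] := ltP (star u t) e.
      apply: nearW => m; rewrite sub0r normrN ger0_norm ?subr_ge0 //.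
      by apply: le_lt_trans eu; rewrite gerBl star_ge0.
    have h0 : 0 <= star u t - e / 2 by lra.
    have h1 : star u t - e / 2 < star u t by lra.
    have := cvgu _ t h0; rewrite -ut // => /(_ h1); apply: filterS => m.
    rewrite -ust // sub0r normrN ger0_norm ?subr_ge0 // => ?; lra.
rewrite -Ns => d0; apply: (cvg_near_dist (f := fun=> N (star u)) _ d0); first exact: cvg_cst.
move=> m; have [_ <-] := car_star (Eus m); exact: norm_dist.
Qed.

End SymmetricSpace.

(** * Compression of sets *)

Section Compression.
Context {R : realType} (n : nat) (Q : finType).
Implicit Types (S : Q -> {set 'I_n}) (a b j : 'I_n).

Lemma card_ord_lt (m : nat) : (m <= n)%N -> #|[set i : 'I_n | (i < m)%N]%SET| = m.
Proof.
move=> mn; rewrite -sum1dep_card -(big_ord_widen n (fun=> 1%N)) //.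
by rewrite sum_nat_const card_ord muln1.
Qed.

Lemma down_closed_mem (S : {set 'I_n}) j :
  (forall a b, (a < b)%N -> b \in S -> a \in S) -> (j \in S) = (j < #|S|)%N.
Proof.
move=> dS; apply/idP/idP => [jS|].
  rewrite -(card_ord_lt (ltn_ord j)); apply: subset_leq_card; apply/fintype.subsetP => i.
  by rewrite inE ltnS leq_eqVlt => /orP[/eqP/val_inj -> //|ij]; exact: dS jS.
apply: contraLR => jS; rewrite -leqNgt -(card_ord_lt (ltnW (ltn_ord j))).
apply: subset_leq_card; apply/fintype.subsetP => i iS; rewrite inE ltnNge leq_eqVlt.
apply/negP => /orP[/eqP/val_inj ji|ji]; first by rewrite ji iS in jS.
by rewrite (dS _ _ ji iS) in jS.
Qed.

Definition count_at S j : R := \sum_q (j \in S q)%:R.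

(** The shifting operation of extremal set theory, applied to all members of the family at once. *)
Definition compress a b S q :=
  if (b \in S q) && (a \notin S q) then a |: (S q :\ b) else S q.

Lemma card_compress a b S q : #|compress a b S q| = #|S q|.
Proof.
rewrite /compress; case: ifP => // /andP[bS aS].
rewrite cardsU1 !inE (negbTE aS) andbF add1n.
by rewrite [RHS](cardsD1 b) bS.
Qed.

(* Compression moves the counts at a and b apart and keeps their sum, so the old counts
   are a convex combination of the new ones and of the new ones with a and b exchanged. *)
Lemma count_compress a b S : a != b ->
  (exists q, (b \in S q) && (a \notin S q)) -> exists2 th : R, 0 <= th <= 1 &
  forall j, count_at S j = th * count_at (compress a b S) j
    + (1 - th) * count_at (compress a b S) (tperm a b j).
Proof.
move=> ab [q0 q0P].
pose r : R := \sum_q ((b \in S q) && (a \notin S q))%:R.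
pose s : R := \sum_q ((a \in S q) && (b \notin S q))%:R.
have r1 : 1 <= r.
  rewrite /r (bigD1 q0) //= q0P lerDl; apply: sumr_ge0 => q _; exact: ler0n.
have s0 : 0 <= s by apply: sumr_ge0 => q _; exact: ler0n.
have Ca : count_at (compress a b S) a = count_at S a + r.
  rewrite /count_at /r -big_split /=; apply: eq_bigr => q _; rewrite /compress.
  case: ifP => [/andP[_ /negbTE ->]|_]; last by rewrite addr0.
  by rewrite !inE eqxx add0r.
have Cb : count_at (compress a b S) b = count_at S b - r.
  rewrite /count_at /r -sumrB /=; apply: eq_bigr => q _; rewrite /compress.
  case: ifP => [/andP[-> _]|_]; last by rewrite subr0.
  by rewrite !inE eqxx eq_sym (negbTE ab) subrr.
have Cj j : j != a -> j != b -> count_at (compress a b S) j = count_at S j.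
  move=> ja jb; apply: eq_bigr => q _; rewrite /compress; case: ifP => // _.
  by rewrite !inE (negbTE ja) jb.
have Cab : count_at S a = count_at S b + s - r.
  rewrite /count_at /r /s -big_split -sumrB /=; apply: eq_bigr => q _.
  by case: (a \in S q); case: (b \in S q) => /=; ring.
(* With c_a - c_b = s - r, this is the solution [th] of c_a = th (c_a + r) + (1 - th)(c_b - r); the
   denominator is positive because some set is really moved. *)
exists (s / (s + r)).
  by apply/andP; split; [rewrite divr_ge0|rewrite ler_pdivrMr]; lra.
have sr : s + r != 0 by rewrite gt_eqF //; lra.
move=> j; have [->|ja] := eqVneq j a.
  by rewrite tpermL Ca Cb Cab; field.
have [->|jb] := eqVneq j b; first by rewrite tpermR Ca Cb Cab; field.
by rewrite tpermD 1?eq_sym // Cj //; ring.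
Qed.

Lemma convex_symmetric_compress (P : ('I_n -> R) -> R) :
  (forall (th : R) c d, 0 <= th <= 1 ->
    P (fun j => th * c j + (1 - th) * d j) <= th * P c + (1 - th) * P d) ->
  (forall c (s : 'S_n), P (fun j => c (s j)) = P c) ->
  forall S, P (count_at S) <= P (fun j => \sum_q (j < #|S q|)%N%:R).
Proof.
move=> Pconv Psym S.
(* Termination measure: a compression with a < b that moves some set lowers the sum of all elements.
   When none is possible, every set is an initial segment of unchanged cardinality. *)
pose w S := (\sum_q \sum_(j in S q) j)%N.
have [m] := ubnP (w S); elim: m S => // m IH S /ltnSE wS.
have [dS|/existsNP[q0 /existsNP[a /existsNP[b /not_implyP[ab /not_implyP[bS /negP aS]]]]]] :=
  pselect (forall q a b, (a < b)%N -> b \in S q -> a \in S q).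
  suff -> : count_at S = (fun j => \sum_q (j < #|S q|)%N%:R) by [].
  by apply/funext => j; apply: eq_bigr => q _; rewrite (down_closed_mem _ (dS q)).
have neq_ab : a != b by apply: contraTneq ab => ->; rewrite ltnn.
have ex_q : exists q, (b \in S q) && (a \notin S q) by exists q0; rewrite bS aS.
apply: (@le_trans _ _ (P (count_at (compress a b S)))).
  have [th th01 E] := count_compress neq_ab ex_q.
  have -> : count_at S = (fun j => th * count_at (compress a b S) j
      + (1 - th) * count_at (compress a b S) (tperm a b j)) by apply/funext.
  apply: le_trans (Pconv _ _ _ th01) _; rewrite Psym; lra.
have -> : (fun j => \sum_q (j < #|S q|)%N%:R) =
    (fun j => \sum_q (j < #|compress a b S q|)%N%:R : R).
  by apply/funext => j; apply: eq_bigr => q _; rewrite card_compress.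
apply: IH; apply: leq_trans wS.
(* The equality case of the [leqif] gives the strict decrease at [q0], the inequality the weak
   decrease at the other indices. *)
have le_w q : (\sum_(j in compress a b S q) j <= \sum_(j in S q) j ?= iff
    ~~ ((b \in S q) && (a \notin S q)))%N.
  rewrite /compress; case: ifPn => [/andP[bSq aSq]|_] /=; last exact/leqif_refl.
  rewrite big_setU1 ?inE ?(negbTE aSq) ?andbF //= [X in (_ <= X ?= iff _)%N](big_setD1 b) //=.
  split; first by rewrite leq_add2r ltnW.
  by rewrite eqn_add2r; apply/negbTE; rewrite neq_ltn ab.
rewrite /w (bigD1 q0) //= [X in (_ < X)%N](bigD1 q0) //= -addSn leq_add //.
  by rewrite ltn_neqAle !le_w bS aS.
by apply: leq_sum => q _; rewrite le_w.
Qed.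

End Compression.

(** A list with [n v] copies of each v other than [v0] is padded with [v0] to length m and read as a
    function; [v0] absorbs the positions left over. *)
Lemma exists_fibers (V : finType) (v0 : V) (n : V -> nat) (m : nat) :
  (\sum_(v | v != v0) n v <= m)%N ->
  exists f : 'I_m -> V, forall v, v != v0 -> #|[set j | f j == v]%SET| = n v.
Proof.
move=> nm; pose s := flatten [seq nseq (n v) v | v <- enum V & v != v0].
have sz : (size s <= m)%N.
  rewrite size_flatten /shape -map_comp sumnE big_map big_filter big_enum_cond /=.
  by under eq_bigr do rewrite size_nseq.
pose s' := s ++ nseq (m - size s) v0.
have szs' : size s' = m by rewrite size_cat size_nseq subnKC.
exists (fun j => nth v0 s' j) => v vv0.
rewrite cardsE cardE size_filter -enumT.
have -> : count (fun j : 'I_m => nth v0 s' j == v) (enum 'I_m) = count_mem v s'.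
  rewrite -[in RHS](mkseq_nth v0 s') szs' /mkseq -val_enum_ord -map_comp [RHS]count_map.
  by rewrite enumT; apply: eq_count => j.
rewrite count_cat count_nseq /= eq_sym (negbTE vv0) mul0n addn0.
rewrite count_flatten -map_comp sumnE big_map big_filter big_enum_cond /=.
under eq_bigr do rewrite count_nseq /=.
rewrite (bigD1 v) //= eqxx mul1n big1 ?addn0 // => w /andP[_ /negbTE wv].
by rewrite wv.
Qed.

Lemma card_fibers (V : finType) (m : nat) (f : 'I_m -> V) (A : pred V) :
  #|[set j | A (f j)]%SET| = (\sum_(v | A v) #|[set j | f j == v]%SET|)%N.
Proof.
rewrite -sum1dep_card (partition_big f A) //=; apply: eq_bigr => v Av.
rewrite -sum1dep_card; apply: eq_bigl => j.
by case: eqP => [->|]; rewrite ?Av ?andbF.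
Qed.

(** * Equal cells and sums of indicator functions *)

Section SimpleFunctions.
Context {R : realType}.
Local Notation mu := (@lebesgue_measure R).

Lemma measure_finU (K : finType) (P : pred K) (F : K -> set R) :
  (forall i, measurable (F i)) -> (forall i j t, F i t -> F j t -> i = j) ->
  mu [set t | exists2 i, P i & F i t] = (\sum_(i | P i) mu (F i))%E.
Proof.
move=> mF disj; have <- : (\sum_(i <- enum K | P i) mu (F i) = \sum_(i | P i) mu (F i))%E.
  by rewrite big_enum_cond.
have -> : [set t | exists2 i, P i & F i t] =
    [set t | exists2 i, (i \in enum K) && P i & F i t].
  by apply/seteqP; split=> t [i Pi Fi]; exists i => //; move: Pi; rewrite mem_enum.
suff : measurable [set t | exists2 i, (i \in enum K) && P i & F i t] /\
  mu [set t | exists2 i, (i \in enum K) && P i & F i t] = (\sum_(i <- enum K | P i) mu (F i))%E by case.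
elim: (enum K) (enum_uniq K) => [_|i r IH /= /andP[ir /IH[mr Er]]].
  rewrite big_nil (_ : [set _ | _] = set0); first by rewrite measure0.
  by rewrite -subset0 => t [].
rewrite big_cons; case: ifPn => Pi.
  have -> : [set t | exists2 j, (j \in i :: r) && P j & F j t] =
      F i `|` [set t | exists2 j, (j \in r) && P j & F j t].
    apply/seteqP; split=> t.
      move=> [j]; rewrite inE => /andP[/orP[/eqP -> _ Fi|jr Pj Fj]]; first by left.
      by right; exists j; rewrite ?jr.
    case=> [Fi|[j /andP[jr Pj] Fj]]; first by exists i; rewrite ?inE ?eqxx.
    by exists j; rewrite // inE jr orbT.
  split; first exact: measurableU.
  rewrite -Er; apply: (@measureU _ _ _ mu _ _ (mF i) mr); rewrite -subset0 => t [Fi [j /andP[jr _] Fj]].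
  by move: ir; rewrite (disj _ _ _ Fi Fj) jr.
suff -> : [set t | exists2 j, (j \in i :: r) && P j & F j t] =
      [set t | exists2 j, (j \in r) && P j & F j t] by [].
apply/seteqP; split=> t [j /andP[jr Pj] Fj]; exists j => //.
  move: jr; rewrite inE => /orP[/eqP ji|->//]; by rewrite -ji Pj in Pi.
by rewrite inE jr orbT.
Qed.

Lemma measure_finU_le (K : finType) (F : K -> set R) : (forall i, measurable (F i)) ->
  (mu (\bigcup_i F i) <= \sum_i mu (F i))%E.
Proof.
move=> mF.
have -> : \bigcup_i F i = [set t | exists2 i, i \in enum K & F i t].
  by apply/seteqP; split=> t [i _ Fi]; exists i => //; rewrite mem_enum.
rewrite -[leRHS]big_enum /=.
suff : measurable [set t | exists2 i, i \in enum K & F i t] /\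
  (mu [set t | exists2 i, i \in enum K & F i t] <= \sum_(i <- enum K) mu (F i))%E by case.
elim: (enum K) => [|i r [mr le_r]].
  rewrite big_nil (_ : [set _ | _] = set0); first by rewrite measure0.
  by rewrite -subset0 => t [].
have -> : [set t | exists2 j, j \in i :: r & F j t] =
    F i `|` [set t | exists2 j, j \in r & F j t].
  apply/seteqP; split=> t.
    move=> [j]; rewrite inE => /orP[/eqP -> Fi|jr Fj]; first by left.
    by right; exists j.
  case=> [Fi|[j jr Fj]]; first by exists i; rewrite ?inE ?eqxx.
  by exists j; rewrite // inE jr orbT.
split; first exact: measurableU.
rewrite big_cons; apply: le_trans (@measureU2 _ _ _ mu _ _ (mF i) mr) _.
by rewrite leeD2l.
Qed.

Definition simple (K : finType) (c : K -> R) (F : K -> set R) (t : R) : R :=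
  \sum_i c i * \1_(F i) t.

Lemma simple_in (K : finType) (c : K -> R) (F : K -> set R) i t :
  (forall i j t, F i t -> F j t -> i = j) -> F i t -> simple c F t = c i.
Proof.
move=> disj Fi; rewrite /simple (bigD1 i) //= indicE mem_set // mulr1 big1 ?addr0 //.
move=> j ji; rewrite indicE memNset ?mulr0 // => Fj.
by move: ji; rewrite (disj _ _ _ Fi Fj) eqxx.
Qed.

Lemma simple_out (K : finType) (c : K -> R) (F : K -> set R) t :
  (forall i, ~ F i t) -> simple c F t = 0.
Proof. by move=> Fn; apply: big1 => j _; rewrite indicE memNset ?mulr0. Qed.

Lemma rdistr_simple (alpha : \bar R) (K : finType) (c : K -> R) (F : K -> set R) (l : R) :
  (forall i, measurable (F i)) -> (forall i, F i `<=` dom alpha) ->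
  (forall i j t, F i t -> F j t -> i = j) -> 0 <= l ->
  rdistr (alpha := alpha) (simple c F) l = (\sum_(i | (l < `|c i|)%R) mu (F i))%E.
Proof.
move=> mF FI disj l0; rewrite rdistrE -measure_finU //; congr (mu _); apply/seteqP; split=> t.
  move=> [It /=]; have [[i Fi]|nF] := pselect (exists i, F i t).
    by rewrite (simple_in c disj Fi) => lc; exists i.
  by rewrite simple_out ?normr0 ?ltNge ?l0 // => i Fi; apply: nF; exists i.
move=> [i lc Fi]; split; first exact: FI Fi.
by rewrite /= (simple_in c disj Fi).
Qed.

End SimpleFunctions.

(** * Functions constant on cells of equal length *)

Section Cells.
Context {R : realType} {alpha : \bar R} (E : banachFunctionSpace alpha).
Hypothesis alpha_gt0 : (0 < alpha)%E.
Hypothesis symE : symmetric_space E.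
Local Notation mu := (@lebesgue_measure R).
Local Notation I := (dom alpha).
Local Notation N := (norm_real E).
Local Notation car := (car_real E).
Local Notation rdistr := (@rdistr R alpha).

Definition cell (d : R) (n : nat) (j : 'I_n) : set R :=
  [set t | j%:R * d <= t < j.+1%:R * d].
Arguments cell : clear implicits.

Section FixedMesh.
Variables (d : R) (n : nat).
Hypotheses (d_gt0 : 0 < d) (nd_alpha : ((n%:R * d)%:E <= alpha)%E).

Lemma cell_itv (j : 'I_n) : cell d n j = `[j%:R * d, j.+1%:R * d[%classic.
Proof. by apply/seteqP; split=> t; rewrite /cell /= in_itv. Qed.

Lemma measurable_cell (j : 'I_n) : measurable (cell d n j).
Proof. by rewrite cell_itv; exact: measurable_itv. Qed.

Lemma mu_cell (j : 'I_n) : mu (cell d n j) = d%:E.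
Proof.
rewrite cell_itv lebesgue_measure_itv /= lte_fin ltr_pM2r // ltr_nat ltnSn -EFinB.
by rewrite -mulrBl -natr1 addrAC subrr add0r mul1r.
Qed.

Lemma cell_bounds (j : 'I_n) t : cell d n j t -> 0 <= t < n%:R * d.
Proof.
move=> /andP[jt tj]; apply/andP; split; first by apply: le_trans jt; rewrite mulr_ge0 // ltW.
by apply: lt_le_trans tj _; rewrite ler_pM2r // ler_nat.
Qed.

Lemma cell_dom (j : 'I_n) : cell d n j `<=` I.
Proof.
move=> t /cell_bounds/andP[t0 tn]; split=> //.
by apply: lt_le_trans nd_alpha; rewrite lte_fin.
Qed.

Lemma cell_inj (i j : 'I_n) t : cell d n i t -> cell d n j t -> i = j.
Proof.
move=> /andP[it ti] /andP[jt tj]; apply/val_inj/eqP; rewrite eqn_leq.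
have := le_lt_trans it tj; have := le_lt_trans jt ti.
by rewrite !ltr_pM2r // !ltr_nat !ltnS => -> ->.
Qed.

Lemma cell_cover t : 0 <= t < n%:R * d -> exists j, cell d n j t.
Proof.
move=> /andP[t0 tn]; have td : 0 <= t / d by rewrite divr_ge0 // ltW.
have /andP[lo hi] := truncn_itv td.
have jn : (Num.truncn (t / d) < n)%N.
  by rewrite -(ltr_nat R); apply: le_lt_trans lo _; rewrite ltr_pdivrMr.
by exists (Ordinal jn); rewrite /cell /= -ler_pdivlMr // lo -ltr_pdivrMr.
Qed.

Definition step (c : 'I_n -> R) : R -> R := simple c (cell d n).

Lemma step_in (c : 'I_n -> R) j t : cell d n j t -> step c t = c j.
Proof. exact: simple_in cell_inj. Qed.

Lemma car_step c : car (step c).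
Proof.
apply: car_sum => j _; apply: carZ; apply: (car_indic alpha_gt0 symE _ (@cell_dom j) _).1.
  exact: measurable_cell.
by rewrite mu_cell ltry.
Qed.

Lemma rdistr_step (c : 'I_n -> R) (l : R) : 0 <= l ->
  rdistr (step c) l = (#|[set j | l < `|c j|]%SET|%:R * d)%:E.
Proof.
move=> l0; rewrite rdistr_simple //; [|exact: measurable_cell|exact: cell_dom|exact: cell_inj].
under eq_bigr do rewrite mu_cell.
rewrite sumEFin mulr_natl -sumr_const; congr (_%:E); apply: eq_bigl => j.
by rewrite inE.
Qed.

(** The cells have equal length, so permuting the values does not change the distribution. *)
Lemma norm_step_perm c (s : 'S_n) : N (step (fun j => c (s j))) = N (step c).
Proof.
apply: (car_sym symE _ (car_step c) _).2; first exact: car_measurable (car_step _).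
move=> l l0; rewrite !rdistr_step //; congr ((_%:R * d)%:E).
rewrite -(card_imset _ (@perm_inj _ s)); apply: eq_card => j; rewrite inE.
apply/imsetP/idP => [[i]|lj]; first by rewrite inE => ? ->.
by exists (s^-1%g j); rewrite ?inE permKV.
Qed.

Lemma stepD c e t : step (fun j => c j + e j) t = step c t + step e t.
Proof. by rewrite /step /simple -big_split; apply: eq_bigr => j _; rewrite mulrDl. Qed.

Lemma stepZ a c t : step (fun j => a * c j) t = a * step c t.
Proof. by rewrite /step /simple mulr_sumr; apply: eq_bigr => j _; rewrite mulrA. Qed.

Lemma norm_step_convex (th : R) c e : 0 <= th <= 1 ->
  N (step (fun j => th * c j + (1 - th) * e j)) <= th * N (step c) + (1 - th) * N (step e).
Proof.
move=> /andP[th0 th1].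
have -> : step (fun j => th * c j + (1 - th) * e j) =
    (fun t => th * step c t + (1 - th) * step e t).
  by apply/funext => t; rewrite stepD !stepZ.
apply: le_trans (normD (carZ _ (car_step c)) (carZ _ (car_step e))) _.
by rewrite !normZ ?ger0_norm ?subr_ge0 //; exact: car_step.
Qed.

(* The constant function with the same integral is an average of the n cyclic shifts. *)
Lemma norm_step_mean c : (forall j, 0 <= c j) -> (0 < n)%N ->
  (\sum_j c j) * N \1_(dom (n%:R * d)%:E) <= n%:R * N (step c).
Proof.
(* The shifts are additions in 'I_m.+1, which has its group structure in successor form; the facts
   about the mesh are put into the goal so that the case analysis on [n] reaches them. *)
move=> c0 n0; have := @car_step; have := @norm_step_perm; have := @cell_cover.
have := @step_in; rewrite /step; have := nd_alpha.
case: n c c0 n0 => // m c c0 _ nd stepin cover stepperm carstep.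
have shift_inj (i : 'I_m.+1) : injective (fun j : 'I_m.+1 => (i + j)%R) by move=> j k /addrI.
have sum_shift (j : 'I_m.+1) : \sum_(i < m.+1) c (i + j)%R = \sum_i c i.
  by rewrite [RHS](reindex_inj (@addIr _ j)).
have Ec (i : 'I_m.+1) : car (simple (fun j => c (perm (shift_inj i) j)) (cell d m.+1)).
  exact: carstep.
apply: (@le_trans _ _ (N (fun t => \sum_(i < m.+1)
    simple (fun j => c (perm (shift_inj i) j)) (cell d m.+1) t))); last first.
  apply: le_trans (norm_sum _ _) _ => //.
  under eq_bigr do rewrite stepperm.
  by rewrite sumr_const card_ord mulr_natl.
have s0 : 0 <= \sum_j c j by apply: sumr_ge0.
have E1 : car (\1_(dom (m.+1%:R * d)%:E)) by exact: car_indic_dom.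
rewrite -[X in X * _]ger0_norm // -normZ //; apply: norm_le; [exact: carZ|exact: car_sum|].
apply: ae_on_all => t It; rewrite indicE.
case: (boolP (t \in _)) => [/set_mem[t0 tn]|_]; last by rewrite mulr0 normr0.
have [|j jt] := cover t; first by rewrite t0 /= -lte_fin.
rewrite mulr1; under [X in _ <= `|X|]eq_bigr => i _ do rewrite (stepin _ _ _ jt) permE.
by rewrite sum_shift.
Qed.

(** Compression turns each [S q] into an initial segment of cells, whose union, of length #|S q| d,
    is contained in [0, a q). *)
Lemma norm_step_count (Q : finType) (S : Q -> {set 'I_n}) (a : Q -> \bar R) :
  (forall q, (a q <= alpha)%E) -> (forall q, (a q < +oo)%E) ->
  (forall q, ((#|S q|%:R * d)%:E <= a q)%E) ->
  N (step (count_at S)) <= N (fun t => \sum_q \1_(dom (a q)) t).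
Proof.
move=> aalpha afin Sa.
have a0 q : (0 <= a q)%E.
  by apply: le_trans (Sa q); rewrite lee_fin mulr_ge0 // ltW.
apply: le_trans (@convex_symmetric_compress _ _ _ (fun c => N (step c))
  norm_step_convex norm_step_perm S) _.
apply: norm_le; first exact: car_step.
  apply: car_sum => q _.
  have afq : a q \is a fin_num by rewrite ge0_fin_numE.
  by rewrite -(fineK afq); apply: car_indic_dom => //; rewrite fineK.
apply: ae_on_all => t _; have [[j jt]|nF] := pselect (exists j, cell d n j t); last first.
  rewrite /step simple_out ?normr0 // => j jt; apply: nF; by exists j.
rewrite (step_in _ jt) !ger0_norm; [|by apply: sumr_ge0|by apply: sumr_ge0].
apply: ler_sum => q _; case: ltnP => [jS|_]; last by rewrite indicE.
rewrite indicE mem_set //; have /andP[t0 _] := cell_bounds jt; split=> //.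
apply: lt_le_trans (Sa q); rewrite lte_fin; have /andP[_ tj] := jt.
by apply: lt_le_trans tj _; rewrite ler_pM2r // ler_nat.
Qed.

End FixedMesh.
End Cells.

(** * Finite families of sets: atoms and their approximation by cells *)

Section Atoms.
Context {R : realType} {alpha : \bar R} (E : banachFunctionSpace alpha).
Hypothesis alpha_gt0 : (0 < alpha)%E.
Hypothesis symE : symmetric_space E.
Hypothesis OC : order_continuous E.
Local Notation mu := (@lebesgue_measure R).
Local Notation I := (dom alpha).
Local Notation N := (norm_real E).
Local Notation car := (car_real E).
Local Notation rdistr := (@rdistr R alpha).

Section Family.
Variables (Q : finType) (A : Q -> set R).
Hypotheses (mA : forall q, measurable (A q)) (AI : forall q, A q `<=` I).

Definition indic_sum (t : R) : R := \sum_q \1_(A q) t.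

(** The atoms of the Boolean algebra generated by the family, indexed by the members that contain
    them. The atom of the empty set is the complement of the union and may have infinite measure. *)
Definition atom (v : {set Q}) : set R := [set t | I t /\ forall q, (t \in A q) = (q \in v)].

Lemma measurable_family : measurable (\bigcup_q A q).
Proof. by apply: fin_bigcup_measurable => [|q _]; [exact: finite_finset|exact: mA]. Qed.

Lemma measurable_atom v : measurable (atom v).
Proof.
have -> : atom v = I `&` \bigcap_(q in [set: Q]) (if q \in v then A q else ~` A q).
  apply/seteqP; split=> t [It tv]; split=> // q.
    by move=> _; have := tv q; case: (q \in v) => [/set_mem|/negbT/negP tA At] //;
      apply: tA; exact: mem_set.
  have := tv q Logic.I; case: (q \in v) => [/mem_set //|tA].
  by apply/negbTE/negP => /set_mem.
apply: measurableI; first exact: measurable_dom.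
apply: fin_bigcap_measurable => [|q _]; first exact: finite_finset.
by case: (q \in v) => //; exact: measurableC.
Qed.

Lemma atom_inj v w t : atom v t -> atom w t -> v = w.
Proof. by move=> [_ tv] [_ tw]; apply/finset.setP => q; rewrite -tv -tw. Qed.

Lemma atom_cover t : I t -> atom [set q | t \in A q]%SET t.
Proof. by move=> It; split=> // q; rewrite inE. Qed.

Lemma indic_sumE : indic_sum = simple (fun v : {set Q} => #|v|%:R) atom.
Proof.
apply/funext => t; have [It|nIt] := pselect (I t).
  rewrite (simple_in _ atom_inj (atom_cover It)) /indic_sum.
  under eq_bigr do rewrite indicE.
  by rewrite -natr_sum -sum1_card; congr (_%:R); rewrite [RHS]big_mkcond /=;
    apply: eq_bigr => q _; rewrite inE; case: (_ \in _).
rewrite simple_out => [|v [//]]; apply: big1 => q _; rewrite indicE memNset //.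
by move=> /AI.
Qed.

Lemma mu_atoms q : mu (A q) = (\sum_(v : {set Q} | q \in v) mu (atom v))%E.
Proof.
rewrite -(@measure_finU _ _ (fun v : {set Q} => q \in v) atom) //; last first.
- exact: atom_inj.
- exact: measurable_atom.
congr (mu _); apply/seteqP; split=> t.
  by move=> At; exists [set q | t \in A q]%SET; [rewrite inE mem_set|exact/atom_cover/(AI At)].
by move=> [v qv [_ tv]]; apply/set_mem; rewrite tv.
Qed.

Lemma rdistr_indic_sum (l : R) : 0 <= l ->
  rdistr indic_sum l = (\sum_(v : {set Q} | (l < #|v|%:R)%R) mu (atom v))%E.
Proof.
move=> l0; rewrite indic_sumE rdistr_simple //.
- by apply: eq_bigl => v; rewrite ger0_norm.
- exact: measurable_atom.
- by move=> v t [].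
- exact: atom_inj.
Qed.

Variable T : R.
Hypotheses (T_gt0 : 0 < T) (T_alpha : (T%:E <= alpha)%E).
Hypothesis UT : (mu (\bigcup_q A q) <= T%:E)%E.
Let K : R := #|{set Q}|%:R.

Lemma mu_nonempty_atoms : (\sum_(v : {set Q} | v != finset.set0) mu (atom v) <= T%:E)%E.
Proof.
rewrite -(@measure_finU _ _ (fun v : {set Q} => v != finset.set0) atom) //; last first.
- exact: atom_inj.
- exact: measurable_atom.
have mV : measurable [set t | exists2 v : {set Q}, v != finset.set0 & atom v t].
  have -> : [set t | exists2 v : {set Q}, v != finset.set0 & atom v t] =
    \bigcup_(v in [set v : {set Q} | v != finset.set0]) atom v.
    by apply/seteqP; split=> t [v ? ?]; exists v.
  by apply: fin_bigcup_measurable => [|v _]; [exact: finite_finset|exact: measurable_atom].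
apply: le_trans UT; apply: le_measure; rewrite ?inE.
- exact: mV.
- exact: measurable_family.
- move=> t [v /set0Pn[q qv] [_ tv]]; exists q => //.
  by apply/set_mem; rewrite tv.
Qed.

(** An atom of measure a receives floor(a/d) cells, d = T/(m+1), and the cells left over go to the
    empty index set. There are enough cells because the nonempty atoms have total measure at most T,
    and rounding loses at most d for each of at most [K] atoms. *)
Lemma cell_partition (m : nat) : exists f : 'I_m.+1 -> {set Q},
  forall B : pred {set Q}, ~~ B finset.set0 ->
  let c := #|[set j | B (f j)]%SET|%:R * (T / m.+1%:R) in
  (c%:E <= \sum_(v | B v) mu (atom v) <= (c + K * (T / m.+1%:R))%:E)%E.
Proof.
pose d := T / m.+1%:R; have d0 : 0 < d by rewrite divr_gt0.
pose a v := fine (mu (atom v)).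
have aE (v : {set Q}) : v != finset.set0 -> mu (atom v) = (a v)%:E.
  move=> v0; rewrite fineK // ge0_fin_numE ?measure_ge0 //.
  apply: le_lt_trans (ltry T); apply: le_trans mu_nonempty_atoms.
  by rewrite (bigD1 v) //= leeDl // sume_ge0.
have a0 v : 0 <= a v by apply: fine_ge0; exact: measure_ge0.
pose n v := Num.truncn (a v / d).
have nlo v : (n v)%:R * d <= a v.
  by rewrite -ler_pdivlMr //; apply: (andP (truncn_itv _)).1; rewrite divr_ge0 // ltW.
have nhi v : a v <= (n v)%:R * d + d.
  by rewrite -[X in _ + X]mul1r -mulrDl natr1 ltW // -ltr_pdivrMr // truncnS_gt.
have sum_n : (\sum_(v | v != finset.set0) n v <= m.+1)%N.
  rewrite -(ler_nat R) natr_sum -(ler_pM2r d0) mulr_suml.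
  have -> : m.+1%:R * d = T by rewrite /d mulrC divfK // pnatr_eq0.
  rewrite -lee_fin; apply: le_trans mu_nonempty_atoms.
  rewrite -sumEFin; apply: lee_sum => v v0; rewrite aE // lee_fin; exact: nlo.
have [f fn] := exists_fibers sum_n.
exists f => B B0; rewrite -/d card_fibers.
have Bn0 v : B v -> v != finset.set0 by apply: contraTneq => ->.
have -> : (\sum_(v | B v) #|[set j | f j == v]%SET|)%N = (\sum_(v | B v) n v)%N.
  by apply: eq_bigr => v /Bn0 /fn.
rewrite natr_sum mulr_suml (eq_bigr (fun v => (a v)%:E)); last by move=> v /Bn0 /aE.
rewrite sumEFin /= !lee_fin; apply/andP; split; first by apply: ler_sum => v _; exact: nlo.
apply: (@le_trans _ _ (\sum_(v | B v) ((n v)%:R * d + d))).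
  by apply: ler_sum => v _; exact: nhi.
rewrite big_split /= lerD2l sumr_const -mulr_natl ler_pM2r // ler_nat.
exact: max_card.
Qed.

Let mesh m : R := T / m.+1%:R.

Let mesh_gt0 m : 0 < mesh m. Proof. by rewrite divr_gt0. Qed.

Let mesh_mul m : m.+1%:R * mesh m = T.
Proof. by rewrite /mesh mulrC divfK // pnatr_eq0. Qed.

Let mesh_alpha m : ((m.+1%:R * mesh m)%:E <= alpha)%E. Proof. by rewrite mesh_mul. Qed.

Let mesh_cvg0 (c : R) : c * mesh m @[m --> \oo] --> (0 : R).
Proof.
have -> : (fun m => c * mesh m) = (fun m => c * T * harmonic m).
  by apply/funext => m; rewrite /mesh mulrA.
by have := cvgMl_tmp (a := c * T : R) (@cvg_harmonic R); rewrite mulr0; exact.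
Qed.

Lemma mu_member q : (mu (A q) <= T%:E)%E.
Proof.
have sub : A q `<=` \bigcup_q A q by exact: bigcup_sup.
apply: le_trans UT; apply: le_measure => //; rewrite inE; first exact: mA.
exact: measurable_family.
Qed.

(** [S m q] collects the cells allotted to the atoms inside [A q]. The resulting step function
    approximates [indic_sum] from below in distribution, with error at most K times the mesh, so
    [norm_cvg_rdistr] yields the norms. *)
Lemma cell_approximation : exists S : forall m, Q -> {set 'I_m.+1},
  [/\ N (step (mesh m) (count_at (S m))) @[m --> \oo] --> N indic_sum,
      forall m q, ((#|S m q|%:R * mesh m)%:E <= mu (A q))%E &
      forall m q, (mu (A q) <= (#|S m q|%:R * mesh m + K * mesh m)%:E)%E].
Proof.
pose f m := projT1 (cid (cell_partition m)).
have fP m := projT2 (cid (cell_partition m)).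
pose S m q := [set j | q \in f m j]%SET.
have countE m j : count_at (S m) j = #|f m j|%:R :> R.
  rewrite /count_at -natr_sum -sum1_card; congr (_%:R); rewrite [RHS]big_mkcond /=.
  by apply: eq_bigr => q _; rewrite inE; case: (_ \in _).
have qB (q : Q) : ~~ (fun v : {set Q} => q \in v) finset.set0 by rewrite inE.
have lB (l : R) : 0 <= l -> ~~ (fun v : {set Q} => l < #|v|%:R) finset.set0.
  by move=> l0; rewrite cards0 -leNgt.
have rstep m l : 0 <= l -> rdistr (step (mesh m) (count_at (S m))) l =
    (#|[set j | l < #|f m j|%:R]%SET|%:R * mesh m)%:E.
  move=> l0; rewrite rdistr_step //; congr ((_%:R * _)%:E); apply: eq_card => j.
  by rewrite !inE countE ger0_norm.
have Estep m : car (step (mesh m) (count_at (S m))) by exact: car_step.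
exists S; split=> [|m q|m q]; last 2 first.
- by rewrite mu_atoms; have /andP[] := fP m (fun v : {set Q} => q \in v) (qB q).
- by rewrite mu_atoms; have /andP[] := fP m (fun v : {set Q} => q \in v) (qB q).
apply: norm_cvg_rdistr => // [|m l l0|l t l0].
- apply: car_sum => q _; apply: (car_indic alpha_gt0 symE (mA q) (@AI q) _).1.
  exact: le_lt_trans (mu_member q) (ltry T).
- by rewrite rstep // rdistr_indic_sum //; have /andP[] := fP m (fun v : {set Q} => l < #|v|%:R) (lB l l0).
rewrite rdistr_indic_sum // => tl.
(* The bounds for m = 0 already show that this extended real is finite. *)
have [D DE] : exists D : R, (\sum_(v : {set Q} | (l < #|v|%:R)%R) mu (atom v))%E = D%:E.
  have /andP[lo hi] := fP 0 (fun v : {set Q} => l < #|v|%:R) (lB l l0).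
  by move: lo hi; case: (\sum_(_ | _) _)%E => [r||] //; exists r.
rewrite DE lte_fin in tl.
have Dt : 0 < D - t by lra.
have Kmesh : \forall m \near \oo, K * mesh m < D - t.
  exact: (cvgr_lt 0) (mesh_cvg0 K) _ Dt.
apply: filterS Kmesh => m Km.
rewrite rstep // lte_fin.
have /andP[_] := fP m (fun v : {set Q} => l < #|v|%:R) (lB l l0); rewrite DE lee_fin -/(mesh m) => ?.
by lra.
Qed.

(** The limits, as the mesh tends to 0, of [norm_step_count] and [norm_step_mean]: aligning all sets
    at 0 can only increase the norm, and averaging over [0, T) can only decrease it. *)
Lemma norm_indic_sum_bounds :
  N indic_sum <= N (fun t => \sum_q \1_(dom (mu (A q))) t) /\
  (\sum_q fine (mu (A q))) * N \1_(dom T%:E) <= T * N indic_sum.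
Proof.
have [S [cvgS loS hiS]] := cell_approximation.
have muAT := mu_member.
split.
  apply: (ler_cvg_to cvgS (@cvg_cst _ (N (fun t => \sum_q \1_(dom (mu (A q))) t)) _ _ _)).
  apply: nearW => m; apply: norm_step_count => // q.
    exact: le_trans (muAT q) T_alpha.
  exact: le_lt_trans (muAT q) (ltry _).
(* Each of the |Q| measures exceeds the total length of its cells by at most K times the mesh. *)
have h1 : (\sum_q fine (mu (A q)) - (#|Q|%:R * K) * mesh m) * N \1_(dom T%:E) @[m --> \oo] -->
    (\sum_q fine (mu (A q)) - 0) * N \1_(dom T%:E).
  by apply: cvgMr_tmp; apply: cvgB; [exact: cvg_cst|exact: mesh_cvg0].
have h2 : T * N (step (mesh m) (count_at (S m))) @[m --> \oo] --> T * N indic_sum.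
  exact: cvgMl_tmp.
have := ler_cvg_to h1 h2; rewrite subr0; apply; apply: nearW => m.
have := norm_step_mean alpha_gt0 symE (mesh_gt0 m) (mesh_alpha m) (c := count_at (S m)).
move=> /(_ (fun j => sumr_ge0 _ (fun q _ => ler0n _ _)) (ltn0Sn m)).
have -> : \sum_j count_at (S m) j = \sum_q #|S m q|%:R :> R.
  rewrite exchange_big /=; apply: eq_bigr => q _; rewrite -sum1_card natr_sum.
  by rewrite [RHS]big_mkcond /=; apply: eq_bigr => j _; case: (_ \in _).
rewrite mesh_mul -(ler_pM2r (mesh_gt0 m)) mulrAC [X in _ <= X]mulrAC mesh_mul.
apply: le_trans; apply: ler_wpM2r; first by apply: norm_ge0; exact: car_indic_dom.
rewrite lerBlDr mulr_suml -mulrA mulr_natl -sumr_const -big_split /=.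
apply: ler_sum => q _; rewrite -lee_fin fineK //.
rewrite ge0_fin_numE ?measure_ge0 //; exact: le_lt_trans (muAT q) (ltry _).
Qed.

End Family.
End Atoms.

(** * Submajorization and the local L1 bound *)

Section Quantization.
Context {R : realType}.

(** For r > 0, the largest multiple of [e] strictly below r, capped at m e. It is written as a
    layer-cake sum so that the quantization of |u| is a combination of indicators of level sets. *)
Definition quantize (e : R) (m : nat) (r : R) : R := \sum_(l < m) e * (l.+1%:R * e < r)%R%:R.

Lemma quantize_ge0 e m r : 0 < e -> 0 <= quantize e m r.
Proof. by move=> e0; apply: sumr_ge0 => l _; rewrite mulr_ge0 // ltW. Qed.

Lemma quantize_le e m r : 0 < e -> 0 <= r -> quantize e m r <= r.
Proof.
move=> e0 r0; suff : quantize e m r <= r /\ quantize e m r <= m%:R * e by case.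
elim: m => [|m [IH1 IH2]]; first by rewrite /quantize big_ord0 mul0r.
rewrite /quantize big_ord_recr /= -/(quantize e m r) -natr1 mulrDl mul1r.
by case: (ltP (m%:R * e + e) r) => h; rewrite ?mulr1 ?mulr0; split; lra.
Qed.

Lemma quantize_ge e m r : 0 < e -> r <= m.+1%:R * e -> r - e <= quantize e m r.
Proof.
(* Either the error is at most [e], or all m steps are climbed and r lies beyond the next one, which
   the bound on r excludes. *)
move=> e0; suff : r - e <= quantize e m r \/ m%:R * e <= quantize e m r /\ m.+1%:R * e < r.
  by case=> // -[_ h] /(lt_le_trans h); rewrite ltxx.
elim: m => [|m IH]; first by rewrite /quantize big_ord0 mul0r mul1r; case: (leP r e) => ?; [left; lra|by right].
rewrite /quantize big_ord_recr /= -/(quantize e m r).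
have : 0 <= e * (m.+1%:R * e < r)%R%:R by rewrite mulr_ge0 // ltW.
case: IH => [?|[? mr]] ?; first by left; lra.
rewrite mr mulr1; case: (leP r (m.+2%:R * e)) => h.
  left; move: h; rewrite -[m.+2%:R]natr1 mulrDl mul1r -natr1 mulrDl mul1r; lra.
right; split=> //; rewrite -natr1 mulrDl mul1r; lra.
Qed.

(** With mesh 1/(m+1), (m+1)^2 steps reach the height m + 1, so the mesh vanishes while the cap
    tends to infinity. *)
Lemma quantize_cvg (r : R) : 0 <= r ->
  quantize m.+1%:R^-1 (m.+1 ^ 2) r @[m --> \oo] --> r.
Proof.
move=> r0; have m0 m : 0 < m.+1%:R^-1 :> R by rewrite invr_gt0.
apply: (@squeeze_cvgr _ _ _ _ (fun m => r - harmonic m) (fun=> r)).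
- exists (Num.truncn r) => // m /= rm; rewrite quantize_le // andbT.
  apply: quantize_ge => //; apply: le_trans (ltW (truncnS_gt r)) _.
  rewrite -ler_pdivrMr // invrK -natrM ler_nat.
  by apply: leq_trans (leqnSn _); rewrite expnS expn1 leq_mul.
- by have := cvgB (@cvg_cst _ r _ _ _) (@cvg_harmonic R); rewrite subr0; exact.
- exact: cvg_cst.
Qed.

End Quantization.

(** * Norms and integrals through level sets *)

Section Integrals.
Context {R : realType} {alpha : \bar R} (E : banachFunctionSpace alpha).
Hypothesis alpha_gt0 : (0 < alpha)%E.
Hypothesis symE : symmetric_space E.
Hypothesis OC : order_continuous E.
Local Notation mu := (@lebesgue_measure R).
Local Notation I := (dom alpha).
Local Notation N := (norm_real E).
Local Notation car := (car_real E).
Local Notation rdistr := (@rdistr R alpha).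

Implicit Types (u v : R -> R) (e : R).

Definition level (u : R -> R) (l : R) : set R := I `&` [set s | l < `|u s|].

Lemma quantize_levels (u : R -> R) e m t : I t ->
  quantize e m `|u t| = \sum_(l < m) e * \1_(level u (l.+1%:R * e)) t.
Proof.
move=> It; apply: eq_bigr => l _; rewrite indicE; congr (_ * _%:R); congr nat_of_bool.
by apply/idP/idP => [h|/set_mem[]//]; apply: mem_set; split.
Qed.

Lemma measurable_level u (l : R) : measurable_fun I u -> measurable (level u l).
Proof. exact: measurable_rlevel. Qed.

Lemma integral_quantize u e m : measurable_fun I u -> 0 < e ->
  (\int[mu]_(t in I) (quantize e m `|u t|)%:E =
   \sum_(l < m) e%:E * rdistr u (l.+1%:R * e))%E.
Proof.
move=> mu_ e0; have mI := measurable_dom alpha.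
under eq_integral => t /set_mem It do rewrite quantize_levels // -sumEFin.
rewrite (@ge0_integral_sum _ _ _ mu _ mI); last 2 first.
- move=> l; apply/measurable_EFinP; apply: measurable_funM; first exact: measurable_cst.
  by apply: measurable_indic; exact: measurable_level.
- by move=> l t _; rewrite lee_fin mulr_ge0 // ltW.
apply: eq_bigr => l _; under eq_integral do rewrite EFinM.
rewrite (@ge0_integralZl_EFin _ _ _ mu _ mI) //; last 2 first.
- by apply/measurable_EFinP; apply: measurable_indic; exact: measurable_level.
- exact: ltW.
rewrite (@integral_indic _ _ _ mu _ mI); last exact: measurable_level.
by rewrite rdistrE setIC setIA setIid.
Qed.

(** Fatou's lemma is used instead of monotone convergence: the grids of mesh 1/(m+1) are not nested,
    so the quantizations do not increase with m. *)
Lemma integral_abs_le u (c : \bar R) : measurable_fun I u ->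
  (forall m, (\int[mu]_(t in I) (quantize m.+1%:R^-1 (m.+1 ^ 2) `|u t|)%:E <= c)%E) ->
  (\int[mu]_(t in I) `|u t|%:E <= c)%E.
Proof.
move=> mu_ le_c; have mI := measurable_dom alpha.
pose f m t : \bar R := (quantize m.+1%:R^-1 (m.+1 ^ 2) `|u t|)%:E.
have e0 m : 0 < m.+1%:R^-1 :> R by rewrite invr_gt0.
have mf m : measurable_fun I (f m).
  apply: (eq_measurable_fun (fun t => (\sum_(l < m.+1 ^ 2) m.+1%:R^-1 *
      \1_(level u (l.+1%:R * m.+1%:R^-1)) t)%:E)).
    by move=> t /set_mem It; rewrite /f quantize_levels.
  apply/measurable_EFinP/measurable_sum => l; apply: measurable_funM.
    exact: measurable_cst.
  by apply: measurable_indic; exact: measurable_level.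
have f0 m t : I t -> (0 <= f m t)%E by move=> _; rewrite lee_fin quantize_ge0.
have := @fatou _ _ _ mu _ mI f mf f0.
have -> : (\int[mu]_(t in I) limn_einf (f ^~ t) = \int[mu]_(t in I) `|u t|%:E)%E.
  apply: eq_integral => t _; apply: (cvg_limn_einf_sup _).1.
  apply: cvg_EFin; first exact: nearW.
  exact: quantize_cvg.
move=> /le_trans; apply; rewrite limn_einf_lim; apply: lime_le; first exact: is_cvg_einfs.
apply: nearW => m; apply: le_trans (le_c m); apply: ereal_inf_lbound.
by exists m => //=.
Qed.

Lemma integral_quantize_le u e m : measurable_fun I u -> 0 < e ->
  (\int[mu]_(t in I) (quantize e m `|u t|)%:E <= \int[mu]_(t in I) `|u t|%:E)%E.
Proof.
move=> mu_ e0; have mI := measurable_dom alpha.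
apply: (@ge0_le_integral _ _ _ mu _ mI).
- by move=> t _; rewrite lee_fin quantize_ge0.
- apply: (eq_measurable_fun (fun t => (\sum_(l < m) e *
      \1_(level u (l.+1%:R * e)) t)%:E)).
    by move=> t /set_mem It; rewrite quantize_levels.
  apply/measurable_EFinP/measurable_sum => l; apply: measurable_funM.
    exact: measurable_cst.
  by apply: measurable_indic; exact: measurable_level.
- by apply/measurable_EFinP; apply: measurableT_comp.
- by move=> t _; rewrite lee_fin quantize_le.
Qed.

(** By [integral_quantize], the integral of a quantization depends on the distribution only. *)
Lemma integral_equimeasurable u v : measurable_fun I u -> measurable_fun I v ->
  (forall l, 0 <= l -> rdistr u l = rdistr v l) ->
  (\int[mu]_(t in I) `|u t|%:E = \int[mu]_(t in I) `|v t|%:E)%E.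
Proof.
have key u' v' : measurable_fun I u' -> measurable_fun I v' ->
    (forall l, 0 <= l -> rdistr u' l = rdistr v' l) ->
    (\int[mu]_(t in I) `|u' t|%:E <= \int[mu]_(t in I) `|v' t|%:E)%E.
  move=> mu_ mv uv; apply: integral_abs_le => // m.
  have e0 : 0 < m.+1%:R^-1 :> R by rewrite invr_gt0.
  apply: le_trans (integral_quantize_le (m.+1 ^ 2) mv e0).
  rewrite !integral_quantize // le_eqVlt; apply/orP; left; apply/eqP.
  by apply: eq_bigr => l _; rewrite uv // mulr_ge0 // ltW.
by move=> mu_ mv uv; apply: le_anti; rewrite !key // => l l0; rewrite uv.
Qed.

Lemma exists_initial_length (b : \bar R) : (b <= alpha)%E -> (b < +oo)%E ->
  exists T : R, [/\ 0 < T, (T%:E <= alpha)%E & (b <= T%:E)%E].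
Proof.
move=> balpha boo; have := alpha_gt0; move: balpha; case: alpha => [r br r0|_ _|//].
  by exists r; split.
case: b boo => [r _|//|_]; last by exists 1; split; rewrite ?leey ?leNye.
exists (`|r| + 1); split; [exact: ltr_wpDl|exact: leey|].
by rewrite lee_fin; apply: le_trans (ler_norm r) _; rewrite lerDl.
Qed.

Lemma mu_family_le (Q : finType) (A : Q -> set R) :
  (forall q, measurable (A q)) -> (forall q, A q `<=` I) ->
  (mu (\bigcup_q A q) <= alpha)%E.
Proof.
move=> mA AI; rewrite -[leRHS](lebesgue_measure_dom (ltW alpha_gt0)).
apply: le_measure; rewrite ?inE; [exact: measurable_family|exact: measurable_dom|].
by move=> t [q _ /AI].
Qed.

(* The Hardy-Littlewood-Polya principle for the submajorization of a sum. *)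
Lemma norm_sum_star (k : nat) (us : 'I_k -> R -> R) : (forall i, car (us i)) ->
  N (fun t => \sum_i `|us i t|) <= N (fun t => \sum_i star (alpha := alpha) (us i) t).
Proof.
move=> Eus; have mus i := car_measurable (Eus i).
have Eabs i : car (fun t => `|us i t|) by have [] := car_abs (Eus i).
have Es i : car (star (alpha := alpha) (us i)) by have [] := car_star alpha_gt0 symE (Eus i).
have Esum : car (fun t => \sum_i `|us i t|) by apply: car_sum.
have ESs : car (fun t => \sum_i star (alpha := alpha) (us i) t) by apply: car_sum.
have sum0 t : 0 <= \sum_i `|us i t| by apply: sumr_ge0 => i _; exact: normr_ge0.
pose e m : R := m.+1%:R^-1; pose M m := (m.+1 ^ 2)%N.
have e0 m : 0 < e m by rewrite invr_gt0.
pose g m t := \sum_i \sum_(l < M m) e m * \1_(level (us i) (l.+1%:R * e m)) t : R.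
pose A m (q : 'I_k * 'I_(M m)) := level (us q.1) (q.2.+1%:R * e m).
have mA m q : measurable (A m q) by exact: measurable_level.
have AI m q : A m q `<=` I by exact: subIsetl.
have gE m : g m = (fun t => e m * indic_sum (A m) t).
  apply/funext => t; rewrite /g /indic_sum pair_big /= mulr_sumr.
  by apply: eq_bigr => -[].
have gI m t : I t -> g m t = \sum_i quantize (e m) (M m) `|us i t|.
  by move=> It; apply: eq_bigr => i _; rewrite quantize_levels.
have g_le m t : I t -> 0 <= g m t <= \sum_i `|us i t|.
  move=> It; rewrite gI //; apply/andP; split.
    by apply: sumr_ge0 => i _; exact: quantize_ge0.
  by apply: ler_sum => i _; exact: quantize_le.
have mg m : measurable_fun I (g m).
  rewrite /g; apply: measurable_sum => i; apply: measurable_sum => l.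
  apply: measurable_funM; first exact: measurable_cst.
  by apply: measurable_indic; exact: measurable_level.
have Eg m : car (g m).
  have [] // := car_solid (mg m) Esum; apply: ae_on_all => t It.
  by have /andP[g0 gs] := g_le m t It; rewrite !ger0_norm.
have muAE m q : mu (A m q) = rdistr (us q.1) (q.2.+1%:R * e m) by rewrite rdistrE.
have muA m q : (mu (A m q) < +oo)%E.
  by rewrite muAE; apply: (rdistr_lty symE OC (Eus _)); rewrite mulr_gt0.
have Ng m : N (g m) <= N (fun t => \sum_i star (alpha := alpha) (us i) t).
  (* The lowest level is [e m], so the union lies in the set where the sum of the |u_i| exceeds
     [e m], which has finite measure. *)
  have muU : (mu (\bigcup_q A m q) < +oo)%E.
    apply: (@le_lt_trans _ _ (rdistr (fun t => \sum_i `|us i t|) (e m))).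
      rewrite rdistrE; apply: le_measure; rewrite ?inE; first exact: measurable_family.
        by apply: measurable_rlevel; exact: car_measurable Esum.
      move=> t [[i l] _ [It /= lt_us]]; split=> //=; rewrite ger0_norm //.
      apply: (@le_lt_trans _ _ (l.+1%:R * e m)); first by rewrite ler_peMl ?(ltW (e0 m)) // ler1n.
      by apply: lt_le_trans lt_us _; rewrite (bigD1 i) //= lerDl sumr_ge0.
    exact: (rdistr_lty symE OC Esum).
  have [T [T0 Talpha UT]] := exists_initial_length (mu_family_le (mA m) (AI m)) muU.
  have [le1 _] := norm_indic_sum_bounds alpha_gt0 symE OC (mA m) (AI m) T0 Talpha UT.
  have EA : car (indic_sum (A m)).
    by apply: car_sum => q _; exact: (car_indic alpha_gt0 symE (mA m q) (AI m q) (muA m q)).1.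
  have muAalpha q : (mu (A m q) <= alpha)%E.
    by rewrite muAE; exact: rdistr_le_alpha.
  have Ed : car (fun t => \sum_q \1_(dom (mu (A m q))) t).
    apply: car_sum => q _.
    have afq : mu (A m q) \is a fin_num by rewrite ge0_fin_numE ?measure_ge0 ?muA.
    by rewrite -(fineK afq); apply: car_indic_dom => //; rewrite fineK.
  rewrite gE normZ // gtr0_norm //.
  apply: le_trans (_ : e m * N (fun t => \sum_q \1_(dom (mu (A m q))) t) <= _).
    by rewrite ler_pM2l.
  rewrite -{1}[e m]gtr0_norm // -normZ //; apply: norm_le => //; first exact: carZ.
  (* Up to a null set, the initial interval of the same measure as a level set of [us i] is the
     level set of [star (us i)] at the same height; the inner sums thus reassemble into
     quantizations of [star (us i)], which lie below it. *)
  have aes : ae_on alpha (fun t => forall i l, 0 <= l ->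
      (l < star (alpha := alpha) (us i) t) = (t%:E < rdistr (us i) l)%E).
    by apply: ae_on_forall => i; apply: (star_gt alpha_gt0 symE (Eus i)).
  apply: ae_onS aes => t It st.
  rewrite !ger0_norm; last 2 first.
  - by apply: sumr_ge0 => i _; exact: star_ge0.
  - by rewrite mulr_ge0 ?(ltW (e0 m)) // sumr_ge0.
  rewrite mulr_sumr.
  rewrite -(pair_big xpredT xpredT (fun (i : 'I_k) (l : 'I_(M m)) => e m * \1_(dom (mu (A m (i, l)))) t)) /=.
  apply: ler_sum => i _.
  apply: le_trans (quantize_le (M m) (e0 m) (star_ge0 (us i) t)).
  rewrite /quantize; apply: ler_sum => l _; rewrite ler_pM2l //.
  have l0 : 0 <= l.+1%:R * e m by rewrite mulr_ge0 // ltW.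
  rewrite indicE st //; case: (boolP (t \in _)) => [/set_mem[_ tA]|//].
  by move: tA; rewrite /= muAE /= => ->.
(* The quantization errors are dominated by the sum of the |u_i| and tend to 0 pointwise. *)
have : N (fun t => \sum_i `|us i t| - g m t) @[m --> \oo] --> (0 : R).
  apply: (order_continuous_real OC Esum) => [m|m|].
  - exact: carB.
  - apply: ae_on_all => t It; have /andP[g0 gs] := g_le m t It.
    by rewrite subr_ge0 gs /= ger0_norm // gerBl.
  - apply: ae_on_all => t It.
    have gs : g m t @[m --> \oo] --> \sum_i `|us i t|.
      under eq_fun do rewrite gI //.
      by apply: cvg_big => [|i _]; [exact: add_continuous|exact: (quantize_cvg (normr_ge0 _))].
    have := cvgB (@cvg_cst _ (\sum_i `|us i t| : R) _ _ _) gs.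
    by rewrite subrr; exact.
move=> d0; have cvN : N (g m) @[m --> \oo] --> N (fun t => \sum_i `|us i t|).
  apply: (cvg_near_dist (f := fun=> N (fun t => \sum_i `|us i t|)) _ d0); first exact: cvg_cst.
  by move=> m; exact: norm_dist.
apply: (ler_cvg_to cvN (@cvg_cst _ (N (fun t => \sum_i star (alpha := alpha) (us i) t)) _ _ _)).
exact: nearW.
Qed.

(** The averaging bound of [norm_indic_sum_bounds], applied to the level sets of [u], gives c = T /
    N \1_[0, T); it depends only on the bound [b] for the measure of the support. *)
Lemma integral_le_norm (b : R) : exists2 c : R, 0 <= c & forall u, car u ->
  (rdistr u 0 <= b%:E)%E -> (\int[mu]_(t in I) `|u t|%:E <= (c * N u)%:E)%E.
Proof.
(* The union of the level sets has measure at most both [b] and alpha, while T must be real and not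
   exceed alpha. *)
have [T [T0 Talpha bT]] : exists T : R, [/\ 0 < T, (T%:E <= alpha)%E & (mine b%:E alpha <= T%:E)%E].
  apply: exists_initial_length; first by rewrite ge_min lexx orbT.
  by apply: le_lt_trans (ltry b); rewrite ge_min lexx.
have phi0 := norm_indic_gt0 alpha_gt0 symE T0 Talpha.
exists (T / N \1_(dom T%:E)) => [|u Eu ub]; first by rewrite divr_ge0 // ltW.
have mu_ := car_measurable Eu.
apply: integral_abs_le => // m.
have e0 : 0 < m.+1%:R^-1 :> R by rewrite invr_gt0.
rewrite integral_quantize //; set e : R := m.+1%:R^-1; set M := (m.+1 ^ 2)%N.
pose A (l : 'I_M) := level u (l.+1%:R * e).
have mA l : measurable (A l) by exact: measurable_level.
have AI l : A l `<=` I by exact: subIsetl.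
have muAE l : mu (A l) = rdistr u (l.+1%:R * e) by rewrite rdistrE.
have muA l : mu (A l) \is a fin_num.
  rewrite ge0_fin_numE ?measure_ge0 // muAE.
  by apply: (rdistr_lty symE OC Eu); rewrite mulr_gt0.
have UT : (mu (\bigcup_l A l) <= T%:E)%E.
  apply: le_trans bT; rewrite le_min mu_family_le // andbT; apply: le_trans ub.
  rewrite rdistrE; apply: le_measure; rewrite ?inE; first exact: measurable_family.
    exact: measurable_rlevel.
  move=> t [l _ [It /= lu]]; split=> //=; apply: le_lt_trans lu.
  by rewrite mulr_ge0 // ltW.
have [_ le2] := norm_indic_sum_bounds alpha_gt0 symE OC mA AI T0 Talpha UT.
have EA : car (indic_sum A).
  apply: car_sum => q _; apply: (car_indic alpha_gt0 symE (mA q) (AI q) _).1.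
  by rewrite -ge0_fin_numE ?measure_ge0.
have NA : e * N (indic_sum A) <= N u.
  rewrite -{1}[e]gtr0_norm // -normZ //; apply: norm_le => //; first exact: carZ.
  apply: ae_on_all => t It; rewrite /indic_sum mulr_sumr -quantize_levels //.
  by rewrite ger0_norm ?quantize_ge0 ?quantize_le.
have -> : (\sum_(l < M) e%:E * rdistr u (l.+1%:R * e) = (e * \sum_l fine (mu (A l)))%:E)%E.
  rewrite mulr_sumr -sumEFin; apply: eq_bigr => l _.
  by rewrite EFinM fineK // muAE.
rewrite lee_fin mulrAC ler_pdivlMr // -mulrA.
apply: le_trans (_ : e * (T * N (indic_sum A)) <= _); first by rewrite ler_pM2l.
by rewrite mulrCA ler_pM2l.
Qed.

End Integrals.

(** * Convergence in measure *)

Lemma ler_dist_of_le (R : realType) (a b x y : R) :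
  a <= b + x -> b <= a + x -> x <= y -> `|a - b| <= y.
Proof. by move=> ? ? ?; rewrite ler_norml; apply/andP; split; lra. Qed.

Section DecreasingCone.
Context {R : realType} {alpha : \bar R} (E : banachFunctionSpace alpha).
Hypothesis alpha_gt0 : (0 < alpha)%E.
Hypothesis symE : symmetric_space E.
Hypothesis OC : order_continuous E.
Local Notation mu := (@lebesgue_measure R).
Local Notation I := (dom alpha).
Local Notation N := (norm_real E).
Local Notation car := (car_real E).
Local Notation rdistr := (@rdistr R alpha).
Local Notation star := (@star R alpha).
Local Notation level := (@level R alpha).
Implicit Types (u v w : R -> R).

Lemma decreasing_cone_star u : car u -> decreasing_cone E (EFin \o star u).
Proof.
move=> Eu; have [Es _] := car_star alpha_gt0 symE Eu.
split=> //; exists (EFin \o u) => //; exact: (star_EFin alpha_gt0 symE Eu).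
Qed.

Lemma decreasing_coneZ (a : R) u : 0 < a -> decreasing_cone E (EFin \o u) ->
  decreasing_cone E (EFin \o (fun t => a * u t)).
Proof.
move=> a0 [Eu [x Ex ux]]; split; first exact: carZ.
exists (fun t => a%:E * x t)%E; first exact: bfs_scale.
apply: ae_onS ux => t _ /= ux; rewrite EFinM ux rearrangementZ //; exact: bfs_L0 Ex.
Qed.

Lemma norm_add_sum_star k u (us : 'I_k -> R -> R) : car u -> (forall i, car (us i)) ->
  N (fun t => `|u t| + \sum_i `|us i t|) <= N (fun t => star u t + \sum_i star (us i) t).
Proof.
move=> Eu Eus; pose f (i : 'I_k.+1) := if unlift ord0 i is Some j then us j else u.
have Ef i : car (f i) by rewrite /f; case: unliftP.
have := norm_sum_star alpha_gt0 symE OC Ef.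
have -> : (fun t => \sum_i `|f i t|) = (fun t => `|u t| + \sum_i `|us i t|).
  apply/funext => t; rewrite big_ord_recl /f unlift_none; congr (_ + _).
  by apply: eq_bigr => i _; rewrite liftK.
have -> // : (fun t => \sum_i star (f i) t) = (fun t => star u t + \sum_i star (us i) t).
apply/funext => t; rewrite big_ord_recl /f unlift_none; congr (_ + _).
by apply: eq_bigr => i _; rewrite liftK.
Qed.

(** The norm of u* + sum u_i* is squeezed between that of u + sum u_i and 1 + sum N (u_i), both of
    which tend to k + 1. *)
Lemma star_cvg k u (us : nat -> R -> R) :
  rotund_real E k [set w : R -> R | decreasing_cone E (EFin \o w)] ->
  car u -> N u = 1 -> ae_on alpha (fun t => 0 <= u t) ->
  (forall n, car (us n)) -> (forall n, ae_on alpha (fun t => 0 <= us n t)) ->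
  N (us n) @[n --> \oo] --> (1 : R) -> tends_to_rotund E k u us ->
  N (fun t => star (us n) t - star u t) @[n --> \oo] --> (0 : R).
Proof.
move=> rot Eu Nu u0 Eus us0 Nus cvgN.
have [Es Ns] := car_star alpha_gt0 symE Eu.
have Ess n : car (star (us n)) by have [] := car_star alpha_gt0 symE (Eus n).
have Nss n : N (star (us n)) = N (us n) by have [] := car_star alpha_gt0 symE (Eus n).
apply: (rotund_real_unnormalized (C := [set w : R -> R | decreasing_cone E (EFin \o w)])
  _ rot Es) => //=.
- by move=> a w; exact: decreasing_coneZ.
- by rewrite Ns.
- exact: decreasing_cone_star.
- by move=> n; split=> //; exact: decreasing_cone_star.
- by under eq_fun do rewrite Nss.
move=> phi hphi.
have h : 1 + \sum_(i < k) N (us (phi i n)) @[n --> \oo] --> (k.+1%:R : R).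
  rewrite -nat1r -[k%:R]mulr1; apply: cvgD; first exact: cvg_cst.
  exact: (cvg_sum_subsequences (e := fun n => N (us n)) hphi Nus).
apply: squeeze_cvgr (cvgN phi hphi) h; apply: nearW => n; apply/andP; split.
  apply: le_trans (norm_add_sum_star Eu (fun i => Eus (phi i n))).
  have Ea w : car w -> car (fun t => `|w t|) by move=> /car_abs[].
  apply: norm_le.
  - by apply: carD => //; apply: car_sum.
  - by apply: carD; [exact: Ea|apply: car_sum => i _; exact: Ea].
  apply: ae_on_all => t _; rewrite [leRHS]ger0_norm; last first.
    by apply: addr_ge0; [exact: normr_ge0|apply: sumr_ge0 => i _; exact: normr_ge0].
  by apply: le_trans (ler_normD _ _) _; rewrite lerD2l; exact: ler_norm_sum.
have Esum : car (fun t => \sum_(i < k) star (us (phi i n)) t) by apply: car_sum.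
apply: le_trans (normD Es Esum) _; rewrite Ns Nu lerD2l.
apply: le_trans (norm_sum _ _) _ => //.
by apply: ler_sum => i _; rewrite Nss.
Qed.

(** From (k + 2)(u + sum u_i) = 2 (u + sum y_i) + (k + 1) sum u_i, where the last sum has norm at
    most k, the norm of u + sum y_i is bounded below by a quantity tending to ((k + 2)(k + 1) - (k +
    1) k)/2 = k + 1. *)
Lemma midpoint_tends k u (us : nat -> R -> R) : car u -> N u = 1 ->
  (forall n, car (us n)) -> (forall n, N (us n) = 1) -> tends_to_rotund E k u us ->
  tends_to_rotund E k u (fun n t => 2^-1 * (u t + us n t)).
Proof.
move=> Eu Nu Eus Nus cvgN phi hphi.
have Ey n : car (fun t => 2^-1 * (u t + us n t)) by apply: carZ; exact: carD.
have Esum n : car (fun t => \sum_(i < k) us (phi i n) t) by apply: car_sum.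
have Ny n : N (fun t => 2^-1 * (u t + us n t)) <= 1.
  rewrite normZ; last exact: carD.
  have := normD Eu (Eus n); rewrite Nu Nus gtr0_norm ?invr_gt0 //; lra.
apply: (@squeeze_cvgr _ _ _ _ (fun n => 2^-1 * (k.+2%:R *
  N (fun t => u t + \sum_(i < k) us (phi i n) t) - k.+1%:R * k%:R)) (fun=> k.+1%:R)).
- apply: nearW => n; apply/andP; split.
    rewrite ler_pdivrMl // lerBlDr.
    have -> : k.+2%:R * N (fun t => u t + \sum_(i < k) us (phi i n) t) =
      N (fun t => k.+2%:R * (u t + \sum_(i < k) us (phi i n) t)).
      by rewrite normZ ?ger0_norm //; exact: carD.
    have EA : car (fun t => 2 * (u t + \sum_(i < k) 2^-1 * (u t + us (phi i n) t))).
      by apply: carZ; apply: carD => //; apply: car_sum => i _; exact: Ey.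
    have -> : 2 * N (fun t => u t + \sum_(i < k) 2^-1 * (u t + us (phi i n) t)) =
      N (fun t => 2 * (u t + \sum_(i < k) 2^-1 * (u t + us (phi i n) t))).
      rewrite normZ ?ger0_norm //; apply: carD => //; apply: car_sum => i _; exact: Ey.
    have -> : (fun t => k.+2%:R * (u t + \sum_(i < k) us (phi i n) t)) =
      (fun t => 2 * (u t + \sum_(i < k) 2^-1 * (u t + us (phi i n) t)) +
                k.+1%:R * \sum_(i < k) us (phi i n) t).
      apply/funext => t; rewrite -mulr_sumr big_split /= sumr_const card_ord -mulr_natl.
      by rewrite -[k.+2%:R]natr1 -[k.+1%:R]natr1; field.
    apply: le_trans (normD EA (carZ _ (Esum n))) _; rewrite lerD2l normZ // ger0_norm //.
    rewrite ler_pM2l ?ltr0n //; apply: le_trans (norm_sum _ _) _ => //.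
    by under eq_bigr do rewrite Nus; rewrite sumr_const card_ord.
  have EA : car (fun t => \sum_(i < k) 2^-1 * (u t + us (phi i n) t)).
    by apply: car_sum => i _; exact: Ey.
  apply: le_trans (normD Eu EA) _; rewrite Nu -[k.+1%:R]nat1r lerD2l.
  apply: le_trans (norm_sum _ _) _; first by move=> i _; exact: Ey.
  apply: (@le_trans _ _ (\sum_(i < k) 1)); first by apply: ler_sum => i _; exact: Ny.
  by rewrite sumr_const card_ord.
- have E1 : 2^-1 * (k.+2%:R * k.+1%:R - k.+1%:R * k%:R) = k.+1%:R :> R.
    by rewrite -[k.+2%:R]natr1 -[k.+1%:R]natr1; field.
  have := cvgMl_tmp (a := 2^-1 : R) (cvgB (cvgMl_tmp (a := k.+2%:R : R) (cvgN _ hphi))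
    (cvg_cst (k.+1%:R * k%:R : R))).
  by rewrite E1; exact.
- exact: cvg_cst.
Qed.

Definition excess (l : R) w (t : R) : R := Num.max (`|w t| - l) 0.

Lemma excess_ge0 l w t : 0 <= excess l w t.
Proof. by rewrite le_max lexx orbT. Qed.

Lemma abs_excess l w t : `|excess l w t| = excess l w t.
Proof. by rewrite ger0_norm ?excess_ge0. Qed.

Lemma measurable_excess l w : measurable_fun I w -> measurable_fun I (excess l w).
Proof.
move=> mw; apply: measurable_maxr; last exact: measurable_cst.
by apply: measurable_funB; [exact: measurableT_comp|exact: measurable_cst].
Qed.

Lemma car_excess l w : 0 <= l -> car w -> car (excess l w).
Proof.
move=> l0 Ew; have [] // := car_solid (measurable_excess l (car_measurable Ew)) Ew.
apply: ae_on_all => t _; rewrite ger0_norm ?excess_ge0 // ge_max normr_ge0 andbT.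
by rewrite gerBl.
Qed.

Lemma rdistr_excess l w m : 0 <= l -> 0 <= m -> rdistr (excess l w) m = rdistr w (l + m).
Proof.
move=> l0 m0; rewrite !rdistrE; congr (mu (_ `&` _)); apply/seteqP.
split=> t /=; rewrite abs_excess /excess lt_max [m < 0]ltNge m0 orbF;
  by rewrite ltrBrDl.
Qed.

Definition integral_excess (l : R) w : R := fine (\int[mu]_(t in I) (excess l w t)%:E)%E.

(** The excess over l > 0 vanishes outside {|w| > l}, a set of finite measure, so the local L1 bound
    applies even when [w] is not integrable. *)
Lemma integral_excess_fin l w : 0 < l -> car w ->
  (\int[mu]_(t in I) (excess l w t)%:E)%E = (integral_excess l w)%:E.
Proof.
move=> l0 Ew; have d_fin : rdistr w l \is a fin_num.
  by rewrite ge0_fin_numE ?measure_ge0 //; exact: (rdistr_lty symE OC Ew).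
have Ex := car_excess (ltW l0) Ew.
have [c _ le_c] := integral_le_norm alpha_gt0 symE OC (fine (rdistr w l)).
rewrite /integral_excess fineK // ge0_fin_numE; last first.
  by apply: integral_ge0 => t _; rewrite lee_fin excess_ge0.
apply: le_lt_trans (ltry (c * N (excess l w))).
have -> : (\int[mu]_(t in I) (excess l w t)%:E = \int[mu]_(t in I) `|excess l w t|%:E)%E.
  by apply: eq_integral => t _; rewrite abs_excess.
by apply: le_c => //; rewrite rdistr_excess ?(ltW l0) // addr0 fineK.
Qed.

Lemma integral_excess_star l w : 0 < l -> car w ->
  integral_excess l (star w) = integral_excess l w.
Proof.
move=> l0 Ew; have [Es _] := car_star alpha_gt0 symE Ew.
rewrite /integral_excess; congr fine.
have abs v : (\int[mu]_(t in I) (excess l v t)%:E = \int[mu]_(t in I) `|excess l v t|%:E)%E.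
  by apply: eq_integral => t _; rewrite abs_excess.
rewrite !abs; apply: integral_equimeasurable.
- exact: measurable_excess (car_measurable Es).
- exact: measurable_excess (car_measurable Ew).
move=> m m0; rewrite !rdistr_excess ?(ltW l0) //.
by rewrite (rdistr_star alpha_gt0 symE Ew) // addr_ge0 // ltW.
Qed.

Lemma rdistr_leU u v w (l l1 l2 : R) : measurable_fun I u -> measurable_fun I v ->
  measurable_fun I w ->
  (forall t, l < `|u t| -> l1 < `|v t| \/ l2 < `|w t|) ->
  (rdistr u l <= rdistr v l1 + rdistr w l2)%E.
Proof.
move=> mu_ mv mw uvw; rewrite !rdistrE.
have mU := measurableU _ _ (measurable_rlevel l1 mv) (measurable_rlevel l2 mw).
apply: le_trans (@measureU2 _ _ _ mu _ _ (measurable_rlevel l1 mv) (measurable_rlevel l2 mw)).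
apply: le_measure; rewrite ?inE; [exact: measurable_rlevel|exact: mU|].
by move=> t [It /uvw[?|?]]; [left|right].
Qed.

(** The difference [g n] of the excesses of the rearrangements is at most |vs_n* - v*|, and it
    vanishes unless v* > l/2 or |vs_n* - v*| > l/2. The second set eventually has measure below 1,
    so the supports have bounded measure and one constant of [integral_le_norm] serves for all large
    n. *)
Lemma integral_excess_cvg l v (vs : nat -> R -> R) : 0 < l -> car v ->
  (forall n, car (vs n)) -> N (fun t => star (vs n) t - star v t) @[n --> \oo] --> (0 : R) ->
  integral_excess l (vs n) @[n --> \oo] --> integral_excess l v.
Proof.
move=> l0 Ev Evs cvg0; have l20 : 0 < l / 2 by rewrite divr_gt0.
have [Es _] := car_star alpha_gt0 symE Ev.
have Ess n : car (star (vs n)) by have [] := car_star alpha_gt0 symE (Evs n).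
have Ed n : car (fun t => star (vs n) t - star v t) by exact: carB.
have d_fin : rdistr (star v) (l / 2) \is a fin_num.
  by rewrite ge0_fin_numE ?measure_ge0 //; exact: (rdistr_lty symE OC Es).
have [c c0 le_c] := integral_le_norm alpha_gt0 symE OC (fine (rdistr (star v) (l / 2)) + 1).
pose g n t := excess l (star (vs n)) t - excess l (star v) t.
have Eg n : car (g n) by apply: carB; apply: car_excess => //; exact: ltW.
have g_le n t : `|g n t| <= `|star (vs n) t - star v t|.
  rewrite /g /excess !(ger0_norm (star_ge0 _ _)) ler_norml.
  by case: (leP (star (vs n) t - l) 0) => ?; case: (leP (star v t - l) 0) => ?;
    case: (ger0P (star (vs n) t - star v t)) => ?; apply/andP; split; lra.
have Ng n : N (g n) <= N (fun t => star (vs n) t - star v t).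
  by apply: norm_le => //; apply: ae_on_all => t _; exact: g_le.
have near_d : \forall n \near \oo, (rdistr (g n) 0 <= (fine (rdistr (star v) (l / 2)) + 1)%:E)%E.
  have := norm_cvg0_measure alpha_gt0 symE Ed cvg0 l20 (ltr01 : 0 < (1 : R)).
  apply: filterS => n dn.
  apply: (@le_trans _ _ (rdistr (star v) (l / 2) +
      rdistr (fun t => star (vs n) t - star v t)%R (l / 2))%E); last first.
    by rewrite EFinD fineK // leeD2l // ltW.
  apply: rdistr_leU; try exact: car_measurable (Eg n).
  - exact: car_measurable Es.
  - exact: car_measurable (Ed n).
  move=> t; rewrite normr_gt0 /g /excess !(ger0_norm (star_ge0 _ _)).
  have [h|h] := ltP (l / 2) (star v t); first by left.
  rewrite [Num.max (star v t - l) 0]max_r; last lra.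
  rewrite subr0; case: (leP (star (vs n) t - l) 0) => [_|h' _]; first by rewrite eqxx.
  by right; apply: lt_le_trans (ler_norm _); lra.
have near_int : \forall n \near \oo,
    `|integral_excess l v - integral_excess l (vs n)| <= c * N (fun t => star (vs n) t - star v t).
  apply: filterS near_d => n gn.
  have mI := measurable_dom alpha.
  have mg := car_measurable (Eg n).
  have mv := measurable_excess l (car_measurable Es).
  have mvs := measurable_excess l (car_measurable (Ess n)).
  have mabsg : measurable_fun I (fun t => `|g n t|) by apply: measurableT_comp.
  have le_int v1 v2 : measurable_fun I (excess l v1) -> measurable_fun I (excess l v2) ->
      (forall t, excess l v1 t <= excess l v2 t + `|g n t|) ->
      (\int[mu]_(t in I) (excess l v1 t)%:E <=
       \int[mu]_(t in I) (excess l v2 t)%:E + \int[mu]_(t in I) `|g n t|%:E)%E.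
    move=> m1 m2 le12.
    rewrite -(@ge0_integralD _ _ _ mu _ mI); last 4 first.
    - by move=> t _; rewrite lee_fin excess_ge0.
    - exact/measurable_EFinP.
    - by move=> t _; rewrite lee_fin.
    - exact/measurable_EFinP.
    apply: (@ge0_le_integral _ _ _ mu _ mI).
    - by move=> t _; rewrite lee_fin excess_ge0.
    - exact/measurable_EFinP.
    - by apply: emeasurable_funD; exact/measurable_EFinP.
    - by move=> t _; rewrite -EFinD lee_fin.
  have int_g := le_c _ (Eg n) gn.
  have c_int : c * N (g n) <= c * N (fun t => star (vs n) t - star v t) by rewrite ler_wpM2l.
  rewrite -(integral_excess_star l0 Ev) -(integral_excess_star l0 (Evs n)).
  have le1 := le_int (star v) (star (vs n)) mv mvs.
  have le2 := le_int (star (vs n)) (star v) mvs mv.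
  have Iv := integral_excess_fin l0 Es; have Ivs := integral_excess_fin l0 (Ess n).
  have {}le1 : integral_excess l (star v) <= integral_excess l (star (vs n)) + c * N (g n).
    have := le1 _; rewrite Iv Ivs => {}le1.
    have h t : excess l (star v) t <= excess l (star (vs n)) t + `|g n t|.
      by rewrite /g -lerBlDl distrC ler_norm.
    by have := le_trans (le1 h) (leeD2l _ int_g); rewrite -EFinD lee_fin.
  have {}le2 : integral_excess l (star (vs n)) <= integral_excess l (star v) + c * N (g n).
    have := le2 _; rewrite Iv Ivs => {}le2.
    have h t : excess l (star (vs n)) t <= excess l (star v) t + `|g n t|.
      by rewrite /g -lerBlDl ler_norm.
    by have := le_trans (le2 h) (leeD2l _ int_g); rewrite -EFinD lee_fin.
  exact: ler_dist_of_le c_int.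
have c_cvg : c * N (fun t => star (vs n) t - star v t) @[n --> \oo] --> (0 : R).
  by have := cvgMl_tmp (a := c) cvg0; rewrite mulr0; exact.
apply: (@squeeze_cvgr _ _ _ _
  (fun n => integral_excess l v - c * N (fun t => star (vs n) t - star v t))
  (fun n => integral_excess l v + c * N (fun t => star (vs n) t - star v t))).
- by apply: filterS near_int => n; rewrite distrC ler_distl.
- by have := cvgB (@cvg_cst _ (integral_excess l v : R) _ _ _) c_cvg; rewrite subr0; exact.
- by have := cvgD (@cvg_cst _ (integral_excess l v : R) _ _ _) c_cvg; rewrite addr0; exact.
Qed.

End DecreasingCone.

(* Midpoint convexity of [r |-> max (r - l) 0], with a gap when [l] separates a and b. *)
Lemma max_sub_midpoint (R : realType) (l e a b r : R) (gap : bool) :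
  0 <= e -> `|r| <= 2^-1 * (a + b) ->
  (gap -> l + e < a /\ b < l - e \/ l + e < b /\ a < l - e) ->
  e / 2 * gap%:R + Num.max (`|r| - l) 0 <=
    2^-1 * Num.max (a - l) 0 + 2^-1 * Num.max (b - l) 0.
Proof.
move=> e0 rab sep.
have {}sep : gap%:R = 0 :> R \/ gap%:R = 1 :> R /\
    (l + e < a /\ b < l - e \/ l + e < b /\ a < l - e).
  by case: gap sep => [/(_ isT) ?|_]; [right|left].
move: (`|r|) rab => s sab.
case: (leP (s - l) 0) => ?; case: (leP (a - l) 0) => ?; case: (leP (b - l) 0) => ?;
  case: sep => [->|[-> [[? ?]|[? ?]]]]; lra.
Qed.

(** The first point of the grid of step e/2 beyond a + e/4 is at most a + 3e/4, hence has distance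
    at least e/4 from both a and b. The number of grid points depends on M and e only. *)
Lemma grid_separation (R : realType) (e a b M : R) : 0 < e -> 0 <= a <= M -> a + e < b ->
  exists j : 'I_(Num.truncn (2 * M / e + 1)).+1,
    a < j.+1%:R * (e / 2) - e / 4 /\ j.+1%:R * (e / 2) + e / 4 < b.
Proof.
move=> e0 /andP[a0 aM] ab; pose q := (a + e / 4) / (e / 2).
have e20 : 0 < e / 2 by rewrite divr_gt0.
have q0 : 0 <= q by rewrite divr_ge0 // ?(ltW e20) //; lra.
have qE : q * (e / 2) = a + e / 4 by rewrite divfK // gt_eqF.
have /andP[lo hi] := truncn_itv q0.
have jlt : (Num.truncn q < (Num.truncn (2 * M / e + 1)).+1)%N.
  rewrite ltnS; apply: le_truncn; rewrite /q.
  have -> : 2 * M / e + 1 = (M + e / 2) / (e / 2) by field; rewrite gt_eqF.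
  by rewrite ler_pM2r ?invr_gt0 //; lra.
exists (Ordinal jlt) => /=.
have : (Num.truncn q)%:R * (e / 2) <= a + e / 4 by rewrite -qE ler_pM2r.
have : a + e / 4 < (Num.truncn q).+1%:R * (e / 2) by rewrite -qE ltr_pM2r.
rewrite -[(Num.truncn q).+1%:R]natr1 mulrDl mul1r => ? ?; split; lra.
Qed.

(** * Separated level sets and convergence in measure *)

Section ConvergenceInMeasure.
Context {R : realType} {alpha : \bar R} (E : banachFunctionSpace alpha).
Hypothesis alpha_gt0 : (0 < alpha)%E.
Hypothesis symE : symmetric_space E.
Hypothesis OC : order_continuous E.
Local Notation mu := (@lebesgue_measure R).
Local Notation I := (dom alpha).
Local Notation N := (norm_real E).
Local Notation car := (car_real E).
Local Notation rdistr := (@rdistr R alpha).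
Local Notation star := (@star R alpha).
Implicit Types (u v w : R -> R).

Definition separated (l e : R) u v : set R :=
  I `&` [set t | l + e < `|u t| /\ `|v t| < l - e \/ l + e < `|v t| /\ `|u t| < l - e].

Lemma measurable_separated l e u v : measurable_fun I u -> measurable_fun I v ->
  measurable (separated l e u v).
Proof.
move=> mu_ mv; have mI := measurable_dom alpha.
have lo w (c : R) : measurable_fun I w -> measurable (I `&` [set t | c < `|w t|]).
  exact: measurable_rlevel.
have hi w (c : R) : measurable_fun I w -> measurable (I `&` [set t | `|w t| < c]).
  move=> mw; have maw : measurable_fun I (fun t => `|w t|) by apply: measurableT_comp.
  have := maw mI _ (measurable_itv `]-oo, c[).
  by congr (measurable (_ `&` _)); apply/seteqP; split=> t; rewrite /= in_itv.
have -> : separated l e u v =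
    ((I `&` [set t | l + e < `|u t|]) `&` (I `&` [set t | `|v t| < l - e])) `|`
    ((I `&` [set t | l + e < `|v t|]) `&` (I `&` [set t | `|u t| < l - e])).
  apply/seteqP; split=> t.
    by move=> [It [[? ?]|[? ?]]]; [left|right]; split; split.
  by move=> [[[It ?] [_ ?]]|[[It ?] [_ ?]]]; split=> //; [left|right].
by apply: measurableU; apply: measurableI; [exact: lo|exact: hi|exact: lo|exact: hi].
Qed.

(** Integration of [max_sub_midpoint], whose gap e/2 is attained on the separated set. The bound is
    small once the excess integrals of [u], [v] and their midpoint are close to each other. *)
Lemma mu_separated_le l e u v : 0 < l -> 0 < e -> car u -> car v ->
  (mu (separated l e u v) <= (2 / e * (2^-1 * integral_excess (alpha := alpha) l u +
    2^-1 * integral_excess (alpha := alpha) l v -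
    integral_excess (alpha := alpha) l (fun t => 2^-1 * (u t + v t))))%:E)%E.
Proof.
move=> l0 e0 Eu Ev; have mI := measurable_dom alpha.
set y := fun t => 2^-1 * (u t + v t).
have Ey : car y by apply: carZ; exact: carD.
have mS := measurable_separated l e (car_measurable Eu) (car_measurable Ev).
set S := separated l e u v in mS *.
have mx w : car w -> measurable_fun I (excess l w).
  by move=> Ew; apply: measurable_excess; exact: car_measurable Ew.
have m1S : measurable_fun I (\1_S : R -> R) by exact: measurable_indic.
have e20 : 0 <= e / 2 by rewrite divr_ge0 // ltW.
have le_int : (\int[mu]_(t in I) ((e / 2 * \1_S t)%:E + (excess l y t)%:E) <=
    \int[mu]_(t in I) ((2^-1 * excess l u t)%:E + (2^-1 * excess l v t)%:E))%E.
  apply: (@ge0_le_integral _ _ _ mu _ mI).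
  - by move=> t _; rewrite -EFinD lee_fin addr_ge0 ?excess_ge0 // mulr_ge0.
  - apply: emeasurable_funD; apply/measurable_EFinP; last exact: mx.
    by apply: measurable_funM; [exact: measurable_cst|].
  - by apply: emeasurable_funD; apply/measurable_EFinP; apply: measurable_funM;
      [exact: measurable_cst|exact: mx|exact: measurable_cst|exact: mx].
  - move=> t It; rewrite -!EFinD lee_fin indicE; apply: max_sub_midpoint.
    + exact: ltW.
    + by rewrite /y normrM gtr0_norm ?invr_gt0 // ler_pM2l ?invr_gt0 // ler_normD.
    + by move=> /set_mem[].
have mc w c : car w -> measurable_fun I (fun t => (c * excess l w t)%:E).
  by move=> Ew; apply/measurable_EFinP; apply: measurable_funM; [exact: measurable_cst|exact: mx].
have half w : car w -> (\int[mu]_(t in I) (2^-1 * excess l w t)%:E =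
    (2^-1 * integral_excess (alpha := alpha) l w)%:E)%E.
  move=> Ew; under eq_integral do rewrite EFinM.
  rewrite (@ge0_integralZl_EFin _ _ _ mu _ mI) ?invr_ge0 //; last 2 first.
  - by move=> t _; rewrite lee_fin excess_ge0.
  - by apply/measurable_EFinP; exact: mx.
  by rewrite (integral_excess_fin alpha_gt0 symE OC l0 Ew).
move: le_int; rewrite (@ge0_integralD _ _ _ mu _ mI); last 4 first.
- by move=> t _; rewrite lee_fin mulr_ge0.
- by apply/measurable_EFinP; apply: measurable_funM; [exact: measurable_cst|].
- by move=> t _; rewrite lee_fin excess_ge0.
- by apply/measurable_EFinP; exact: mx.
rewrite (@ge0_integralD _ _ _ mu _ mI); last 4 first.
- by move=> t _; rewrite lee_fin mulr_ge0 ?excess_ge0 // invr_ge0.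
- exact: mc.
- by move=> t _; rewrite lee_fin mulr_ge0 ?excess_ge0 // invr_ge0.
- exact: mc.
rewrite !half // (integral_excess_fin alpha_gt0 symE OC l0 Ey).
under eq_integral do rewrite EFinM.
rewrite (@ge0_integralZl_EFin _ _ _ mu _ mI) //; last exact/measurable_EFinP.
have -> : (\int[mu]_(t in I) (\1_S t)%:E)%E = mu S.
  have SI : S `&` I = S by apply: setIidl; exact: subIsetl.
  by rewrite (@integral_indic _ _ _ mu _ mI) // SI.
have : (0 <= mu S)%E by exact: measure_ge0.
case: (mu S) => [s|_|//]; last by rewrite gt0_muley ?lte_fin ?divr_gt0 // -EFinD.
move=> _; rewrite -EFinM -!EFinD !lee_fin.
move: (integral_excess _ u) (integral_excess _ v) (integral_excess _ y) => a b c abc.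
have {}abc : e / 2 * s <= 2^-1 * a + 2^-1 * b - c by rewrite lerBrDr.
have -> : s = 2 / e * (e / 2 * s) by field; rewrite gt_eqF.
by rewrite ler_pM2l // divr_gt0.
Qed.

Lemma cvg_in_measure k u (us : nat -> R -> R) : (0 < k)%N ->
  rotund_real E k [set w : R -> R | decreasing_cone E (EFin \o w)] ->
  car u -> N u = 1 -> ae_on alpha (fun t => 0 <= u t) ->
  (forall n, car (us n)) -> (forall n, N (us n) = 1) ->
  (forall n, ae_on alpha (fun t => 0 <= us n t)) -> tends_to_rotund E k u us ->
  forall e eta : R, 0 < e -> 0 < eta ->
  \forall n \near \oo, (rdistr (fun t => `|us n t| - `|u t|)%R e < eta%:E)%E.
Proof.
move=> k0 rot Eu Nu u0 Eus Nus us0 tends e eta e0 eta0.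
pose y n t := 2^-1 * (u t + us n t).
have Es n : car (fun t => u t + us n t) by exact: carD.
have Ey n : car (y n) by exact: carZ.
have y0 n : ae_on alpha (fun t => 0 <= y n t).
  by apply: (ae_onS2 u0 (us0 n)) => t _ ? ?; rewrite mulr_ge0 ?invr_ge0 ?addr_ge0.
have Ny : N (y n) @[n --> \oo] --> (1 : R).
  have NyE n : N (y n) = 2^-1 * N (fun t => u t + us n t).
    by rewrite normZ // ger0_norm // invr_ge0.
  under eq_fun do rewrite NyE.
  have := cvgMl_tmp (a := 2^-1 : R) (norm_pair_cvg k0 Eu Nu Eus Nus tends).
  by rewrite mulVf //; exact.
have us1 : N (us n) @[n --> \oo] --> (1 : R) by under eq_fun do rewrite Nus; exact: cvg_cst.
have star_us := star_cvg alpha_gt0 symE OC rot Eu Nu u0 Eus us0 us1 tends.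
have star_y := star_cvg alpha_gt0 symE OC rot Eu Nu u0 Ey y0 Ny
  (midpoint_tends Eu Nu Eus Nus tends).
pose G l w := integral_excess (alpha := alpha) l w.
(* [e / 4] is the margin provided by [grid_separation]. *)
pose b l n := 2 / (e / 4) * (2^-1 * G l u + 2^-1 * G l (us n) - G l (y n)).
have b_cvg l : 0 < l -> b l n @[n --> \oo] --> (0 : R).
  move=> l0; have := integral_excess_cvg alpha_gt0 symE OC l0 Eu Eus star_us.
  have := integral_excess_cvg alpha_gt0 symE OC l0 Eu Ey star_y => Gy Gus.
  have := cvgMl_tmp (a := 2 / (e / 4) : R) (cvgB (cvgD (cvg_cst (2^-1 * G l u : R))
    (cvgMl_tmp (a := 2^-1 : R) Gus)) Gy).
  have -> : 2^-1 * G l u + 2^-1 * integral_excess (alpha := alpha) l u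
    - integral_excess (alpha := alpha) l u = 0 by rewrite /G; field.
  by rewrite mulr0; exact.
(* Chebyshev with M = 2 / N \1_[0, eta/2): otherwise 2 <= N u = 1. If eta/2 exceeds alpha, any M
   will do. *)
have [M M0 uM] : exists2 M : R, 0 < M & (rdistr u M < (eta / 2)%:E)%E.
  have mu_ := car_measurable Eu.
  have [ealpha|ealpha] := leP (eta / 2)%:E alpha; last first.
    by exists 1 => //; apply: le_lt_trans ealpha; exact: rdistr_le_alpha.
  have phi0 : 0 < N \1_(dom (eta / 2)%:E).
    by apply: (norm_indic_gt0 alpha_gt0 symE _ ealpha); rewrite divr_gt0.
  exists (2 / N \1_(dom (eta / 2)%:E)); first by rewrite divr_gt0.
  rewrite ltNge; apply/negP => /(norm_chebyshev alpha_gt0 symE Eu).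
  by rewrite divfK ?gt_eqF // Nu divr_ge0 // ?(ltW phi0) // => /(_ isT); lra.
pose J := (Num.truncn (2 * M / e + 1)).+1; pose l (j : 'I_J) := j.+1%:R * (e / 2).
have l0 j : 0 < l j by rewrite mulr_gt0 // divr_gt0.
have sum_b : \sum_(j < J) b (l j) n @[n --> \oo] --> (0 : R).
  have : \sum_(j < J) b (l j) n @[n --> \oo] --> \sum_(j < J) (0 : R).
    by apply: cvg_big => [|j _]; [exact: add_continuous|exact: b_cvg].
  by rewrite big1.
have eta20 : 0 < eta / 2 by rewrite divr_gt0.
have near_b : \forall n \near \oo, \sum_(j < J) b (l j) n < eta / 2.
  exact: (cvgr_lt 0) sum_b _ eta20.
apply: filterS near_b => n bn.
have mun := car_measurable (Eus n); have mu_ := car_measurable Eu.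
have mS (j : 'I_J) := measurable_separated (l j) (e / 4) mu_ mun.
pose S (j : 'I_J) := separated (l j) (e / 4) u (us n).
have mS' : measurable (\bigcup_j S j).
  by apply: fin_bigcup_measurable => [|j _]; [exact: finite_finset|exact: mS].
have muS : (mu (\bigcup_j S j) <= (\sum_(j < J) b (l j) n)%:E)%E.
  rewrite -sumEFin; apply: le_trans (measure_finU_le mS) _.
  by apply: lee_sum => j _; apply: mu_separated_le => //; rewrite divr_gt0.
apply: (@le_lt_trans _ _ (rdistr u M + mu (\bigcup_j S j))%E).
  have mM := measurable_rlevel M mu_.
  rewrite !rdistrE; apply: le_trans (@measureU2 _ _ _ mu _ _ mM mS').
  apply: le_measure; rewrite ?inE.
  - apply: measurable_rlevel; apply: measurable_funB; exact: measurableT_comp.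
  - exact: measurableU.
  move=> t [It /= et]; have [Mu|uMt] := ltP M `|u t|; first by left.
  (* For a grid level to fit, the smaller of the two values must be at most M; in both cases |u| <=
     M ensures this. *)
  right; have [ab|ab] := leP `|us n t| `|u t|.
    have lt_e : `|us n t| + e < `|u t|.
      by rewrite ler0_norm ?subr_le0 // in et; lra.
    have bnd : 0 <= `|us n t| <= M by rewrite normr_ge0 /=; exact: le_trans uMt.
    by have [j [j1 j2]] := grid_separation e0 bnd lt_e; exists j => //; split=> //; left.
  have lt_e : `|u t| + e < `|us n t|.
    by rewrite ger0_norm ?subr_ge0 ?(ltW ab) // in et; lra.
  have bnd : 0 <= `|u t| <= M by rewrite normr_ge0.
  by have [j [j1 j2]] := grid_separation e0 bnd lt_e; exists j => //; split=> //; right.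
rewrite [eta]splitr EFinD; apply: lteD => //.
by apply: le_lt_trans muS _; rewrite lte_fin.
Qed.

End ConvergenceInMeasure.

(** * From the decreasing cone to the positive cone *)

Section NormConvergence.
Context {R : realType} {alpha : \bar R} (E : banachFunctionSpace alpha).
Hypothesis alpha_gt0 : (0 < alpha)%E.
Hypothesis symE : symmetric_space E.
Hypothesis OC : order_continuous E.
Local Notation N := (norm_real E).
Local Notation car := (car_real E).
Local Notation rdistr := (@rdistr R alpha).
Local Notation star := (@star R alpha).
Implicit Types (u v w : R -> R).

(** Convergence in measure controls rearrangements at t > 0 only; at t = 0 they take the essential
    supremum, which need not tend to 0. *)
Lemma ae_on_gt0 : ae_on alpha (fun t => 0 < t).
Proof.
exists [set 0]; split; [exact: measurable_set1|exact: lebesgue_measure_set1|].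
move=> t /= /not_implyP[[t0 _] /negP]; rewrite -leNgt => t0'.
by apply/eqP; rewrite eq_le t0 t0'.
Qed.

(** Convergence in measure makes [star (zs n)] tend to 0 at every t > 0, and the minimum with
    [star u] supplies the fixed majorant that order continuity requires. *)
Lemma norm_min_star_cvg0 u (zs : nat -> R -> R) : car u -> (forall n, car (zs n)) ->
  (forall e eta : R, 0 < e -> 0 < eta ->
    \forall n \near \oo, (rdistr (zs n) e < eta%:E)%E) ->
  (forall n, car (fun t => Num.min (star (zs n) t) (star u t))) /\
  N (fun t => Num.min (star (zs n) t) (star u t)) @[n --> \oo] --> (0 : R).
Proof.
move=> Eu Ezs cvgm; have [Es _] := car_star alpha_gt0 symE Eu.
have Ess n : car (star (zs n)) by have [] := car_star alpha_gt0 symE (Ezs n).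
have min_le n t : 0 <= Num.min (star (zs n) t) (star u t) <= `|star u t|.
  by rewrite ger0_norm ?star_ge0 // le_min !star_ge0 ge_min lexx orbT.
have Em n : car (fun t => Num.min (star (zs n) t) (star u t)).
  have mm : measurable_fun (dom alpha) (fun t => Num.min (star (zs n) t) (star u t)).
    by apply: measurable_minr; [exact: car_measurable (Ess n)|exact: car_measurable Es].
  have [] // := car_solid mm Es; apply: ae_on_all => t _.
  by have /andP[m0 ?] := min_le n t; rewrite (ger0_norm m0).
split=> //; apply: (order_continuous_real OC Es) => // [n|].
  exact: ae_on_all.
have aes : ae_on alpha (fun t => forall n l, 0 <= l ->
    (l < star (zs n) t) = (t%:E < rdistr (zs n) l)%E).
  by apply: ae_on_forall => n; exact: (star_gt alpha_gt0 symE (Ezs n)).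
apply: (ae_onS2 ae_on_gt0 aes) => t _ t0 st.
apply/cvgrPdist_le => e e0; apply: filterS (cvgm e t e0 t0) => n dn.
have /andP[m0 _] := min_le n t; rewrite sub0r normrN ger0_norm // ge_min; apply/orP; left.
by rewrite leNgt st ?(ltW e0) // -leNgt ltW.
Qed.

Lemma rotund_decreasing_pos k : (0 < k)%N ->
  rotund_real E k [set w : R -> R | decreasing_cone E (EFin \o w)] ->
  rotund_real E k [set w : R -> R | ae_on alpha (fun t => 0 <= w t)].
Proof.
move=> k0 rot u us Eu Nu u0 EC tends.
have Eus n : car (us n) by have [] := EC n.
have Nus n : N (us n) = 1 by have [] := EC n.
have us0 n : ae_on alpha (fun t => 0 <= us n t) by have [] := EC n.
have in_measure := cvg_in_measure alpha_gt0 symE OC k0 rot Eu Nu u0 Eus Nus us0 tends.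
have us1 : N (us n) @[n --> \oo] --> (1 : R) by under eq_fun do rewrite Nus; exact: cvg_cst.
have star_us := star_cvg alpha_gt0 symE OC rot Eu Nu u0 Eus us0 us1 tends.
have [Es _] := car_star alpha_gt0 symE Eu.
have Ess n : car (star (us n)) by have [] := car_star alpha_gt0 symE (Eus n).
have Ed n : car (fun t => us n t - u t) by exact: carB.
pose W n t := Num.max (us n t - u t) 0; pose V n t := Num.max (u t - us n t) 0.
have mW n : measurable_fun (dom alpha) (W n).
  apply: measurable_maxr; last exact: measurable_cst.
  by apply: measurable_funB; [exact: car_measurable (Eus n)|exact: car_measurable Eu].
have mV n : measurable_fun (dom alpha) (V n).
  apply: measurable_maxr; last exact: measurable_cst.
  by apply: measurable_funB; [exact: car_measurable Eu|exact: car_measurable (Eus n)].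
have W_le n t : `|W n t| <= `|us n t - u t|.
  by rewrite /W; case: (leP (us n t - u t) 0); rewrite ?normr0.
have V_le n t : `|V n t| <= `|us n t - u t|.
  by rewrite /V distrC; case: (leP (u t - us n t) 0); rewrite ?normr0.
have EW n : car (W n).
  by have [] // := car_solid (mW n) (Ed n); exact: ae_on_all.
have EV n : car (V n).
  by have [] // := car_solid (mV n) (Ed n); exact: ae_on_all.
have small (Z : nat -> R -> R) : (forall n, car (Z n)) ->
    (forall n t, `|Z n t| <= `|us n t - u t|) -> forall e eta : R, 0 < e -> 0 < eta ->
    \forall n \near \oo, (rdistr (Z n) e < eta%:E)%E.
  move=> EZ Z_le e eta e0 eta0; apply: filterS (in_measure e eta e0 eta0) => n.
  apply: le_lt_trans; apply: rdistr_le.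
  - exact: car_measurable (EZ n).
  - by apply: measurable_funB; apply: measurableT_comp => //;
      [exact: car_measurable (Eus n)|exact: car_measurable Eu].
  apply: (ae_onS2 u0 (us0 n)) => t _ ut ust; apply: le_trans (Z_le n t) _.
  by rewrite (ger0_norm ut) (ger0_norm ust).
have [EmW minW] := norm_min_star_cvg0 Eu EW (small W EW W_le).
have [EmV minV] := norm_min_star_cvg0 Eu EV (small V EV V_le).
(* 0 <= V_n <= u almost everywhere, so the minimum with [star u] changes nothing. *)
have NV n : N (V n) <= N (fun t => Num.min (star (V n) t) (star u t)).
  have [EsV <-] := car_star alpha_gt0 symE (EV n).
  apply: norm_le => //.
  have V_le_u : ae_on alpha (fun t => `|V n t| <= `|u t|).
    apply: (ae_onS2 u0 (us0 n)) => t _ ut ust; rewrite /V.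
    by case: (leP (u t - us n t) 0) => h; rewrite ?normr0 // gtr0_norm // ger0_norm // gerBl.
  apply: ae_onS (star_le alpha_gt0 symE (EV n) Eu V_le_u) => t _ sVu.
  by rewrite min_l.
(* The majorant [star (us n)] of [star (W n)] varies with n; replacing it by [star u] costs at most
   |us_n* - u*|, whose norm tends to 0. *)
have NW n : N (W n) <= N (fun t => Num.min (star (W n) t) (star u t)) +
    N (fun t => star (us n) t - star u t).
  have [EsW <-] := car_star alpha_gt0 symE (EW n).
  have Esd : car (fun t => star (us n) t - star u t) by exact: carB.
  have [Eabs Nabs] := car_abs Esd.
  rewrite -Nabs; apply: le_trans (normD (EmW n) Eabs); apply: norm_le => //.
    exact: carD.
  have W_le_us : ae_on alpha (fun t => `|W n t| <= `|us n t|).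
    apply: (ae_onS2 u0 (us0 n)) => t _ ut ust; rewrite /W.
    by case: (leP (us n t - u t) 0) => h; rewrite ?normr0 // gtr0_norm // ger0_norm // gerBl.
  apply: ae_onS (star_le alpha_gt0 symE (EW n) (Eus n) W_le_us) => t _ sWus.
  apply: le_trans (ler_norm _); rewrite ger0_norm ?star_ge0 //.
  have := ler_norm (star (us n) t - star u t).
  have := normr_ge0 (star (us n) t - star u t).
  by move: sWus; case: (leP (star (W n) t) (star u t)) => *; lra.
apply: (cvg0_le (e := fun n => (N (fun t => Num.min (star (W n) t) (star u t)) +
  N (fun t => star (us n) t - star u t)) + N (fun t => Num.min (star (V n) t) (star u t)))).
  by have := cvgD (cvgD minW star_us) minV; rewrite !addr0; exact.
move=> n; rewrite norm_ge0 //=.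
have -> : (fun t => us n t - u t) = (fun t => W n t + (-1) * V n t).
  apply/funext => t; rewrite /W /V.
  by case: (leP (us n t - u t) 0) => ?; case: (leP (u t - us n t) 0) => ?; lra.
apply: le_trans (normD (EW n) (carZ _ (EV n))) _.
by rewrite normZ // normrN1 mul1r lerD.
Qed.

End NormConvergence.

Lemma locally_fully_rotund_sub (R : realType) (alpha : \bar R) (k : nat)
    (E : banachFunctionSpace alpha) (C C' : set (R -> \bar R)) :
  C' `<=` C -> locally_fully_rotund k E C -> locally_fully_rotund k E C'.
Proof.
move=> C'C rot x xs [Sx Cx] Sxs; apply: rot; first by split=> //; exact: C'C.
by move=> n; have [Sn Cn] := Sxs n; split=> //; exact: C'C.
Qed.

Local Open Scope ereal_scope.

Theorem theorem4p7 (R : realType) (alpha : \bar R)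
    (halpha : alpha = 1%:E \/ alpha = +oo)
    (k : nat) (hk : (2 <= k)%N)
    (E : banachFunctionSpace alpha)
    (hsym : symmetric_space E) (hfatou : fatou_property E) :
  [/\ locally_fully_rotund k E (bfs_car E) <->
        locally_fully_rotund k E (positive_cone E),
      locally_fully_rotund k E (positive_cone E) ->
        locally_fully_rotund k E (decreasing_cone E) &
      order_continuous E ->
        locally_fully_rotund k E (decreasing_cone E) ->
        locally_fully_rotund k E (bfs_car E)].
Proof.
have alpha_gt0 : 0 < alpha by case: halpha => ->; rewrite ?lte_fin ?ltry.
split=> [||OC rot].
- split; first by apply: locally_fully_rotund_sub => x [].
  move=> /rotund_real_of rot; apply: rotund_real_to; apply: (rotund_real_pos hk).
  by apply: rotund_real_sub rot => u Eu u0; split.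
- apply: locally_fully_rotund_sub => y [Ey [x _ yx]]; split=> //.
  by apply: ae_onS yx => t _ ->; exact: rearrangement_ge0.
- apply: rotund_real_to; apply: (rotund_real_pos hk).
  apply: (rotund_decreasing_pos alpha_gt0 hsym OC (ltnW hk)).
  exact: rotund_real_of.
Qed.
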